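(* Let $d \ge 1$, let $\alpha$ and $\beta$ be two irrational vectors in $\mathbb{R}^d$, and let $T$ be an invertible linear map on $\mathbb{R}^d$. Then the following are equivalent: (a) for every Riemann measurable set $S\subset \mathbb{R}^d$ which is a bounded remainder set with respect to $\alpha$, the image $T(S)$ is a bounded remainder set with respect to $\beta$; (b) $T(\mathbb{Z}\alpha+\mathbb{Z}^d) \subset \mathbb{Z}\beta+\mathbb{Z}^d$.
   Context: A vector $\alpha = (\alpha_1,\dots,\alpha_d) \in \mathbb{R}^d$ is called irrational if $1, \alpha_1, \ldots, \alpha_d$ are linearly independent over $\mathbb{Q}$. We write $\mathbb{Z}\alpha+\mathbb{Z}^d = \{ n\alpha + m : n \in \mathbb{Z}, m \in \mathbb{Z}^d\}$ and $\mathbb{T}^d = \mathbb{R}^d/\mathbb{Z}^d$. For a bounded measurable set $S \subset \mathbb{R}^d$ let $\chi_S(x) = \sum_{k \in \mathbb{Z}^d} \mathbf{1}_S(x+k)$, a $\mathbb{Z}^d$-periodic function regarded as a function on $\mathbb{T}^d$. A bounded measurable set $S \subset \mathbb{R}^d$ is a bounded remainder set (BRS) with respect to an irrational vector $\alpha$ if there is a constant $C = C(S,\alpha)$ such that for every $n \geq 1$ and almost every $x \in \mathbb{T}^d$, $\left| \sum_{k=0}^{n-1} \chi_S(x+k\alpha) - n \operatorname{mes} S \right| \leq C$, where $\operatorname{mes}$ is Lebesgue measure. A bounded set in $\mathbb{R}^d$ is Riemann measurable if its boundary has Lebesgue measure zero. *)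

(* Defs.v *)
From HB Require Import structures.
From mathcomp Require Import all_boot all_order all_algebra.
From mathcomp Require Import all_classical all_reals all_analysis.

Set Implicit Arguments.
Unset Strict Implicit.
Unset Printing Implicit Defensive.

Import Order.TTheory GRing.Theory Num.Theory.
Import numFieldNormedType.Exports.

Local Open Scope classical_set_scope.
Local Open Scope ring_scope.

Section lebesgue_outer.
Context (R : realType) (d : nat).
Local Open Scope ereal_scope.

(* The half-open box \prod_i ]a_i, b_i]; it may be empty. *)
Definition box (ab : 'rV[R]_d * 'rV[R]_d) : set 'rV[R]_d :=
  [set x | forall i, (ab.1 ord0 i < x ord0 i <= ab.2 ord0 i)%R].

Definition box_volume (ab : 'rV[R]_d * 'rV[R]_d) : R :=
  (\prod_(i < d) Num.max 0 (ab.2 ord0 i - ab.1 ord0 i))%R.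

(* Families of boxes are indexed by a subset of nat, so finite (and empty)
   families are included; this makes the outer measure of set0 equal to 0 also
   in dimension 0, where no box is empty. *)
Definition box_cover (A : set 'rV[R]_d) :
    set (set nat * (nat -> 'rV[R]_d * 'rV[R]_d)) :=
  [set F | A `<=` \bigcup_(k in F.1) box (F.2 k)].

Definition lebesgue_outer (A : set 'rV[R]_d) : \bar R :=
  ereal_inf [set \esum_(k in F.1) (box_volume (F.2 k))%:E | F in box_cover A].

Lemma box_volume_ge0 ab : (0 <= box_volume ab)%R.
Proof. by apply: prodr_ge0 => i _; rewrite le_max lexx. Qed.

Let vol_ge0 ab : 0 <= (box_volume ab)%:E.
Proof. by rewrite lee_fin box_volume_ge0. Qed.

Lemma lebesgue_outer_ge0 A : 0 <= lebesgue_outer A.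
Proof. by apply: le_ereal_inf_tmp => _ [F _ <-]; exact: esum_ge0. Qed.

Lemma lebesgue_outer0 : lebesgue_outer set0 = 0.
Proof.
apply/eqP; rewrite eq_le lebesgue_outer_ge0 andbT.
apply: ereal_inf_lbound; exists (set0, fun=> (0, 0)%R); first by move=> x [].
by rewrite /= esum_set0.
Qed.

Lemma le_lebesgue_outer :
  {homo lebesgue_outer : A B / A `<=` B >-> A <= B}.
Proof.
move=> A B AB; apply: ereal_inf_le_tmp => _ [F BF <-].
by exists F => //; exact: subset_trans AB BF.
Qed.

Lemma lebesgue_outer_sigma_subadditive : sigma_subadditive lebesgue_outer.
Proof.
move=> A; have [[i ioo]|] := pselect (exists i, lebesgue_outer (A i) = +oo).
  rewrite (eseries_pinfty _ _ ioo) ?leey// => n _.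
  by rewrite -ltNye (lt_le_trans _ (lebesgue_outer_ge0 _)).
rewrite -forallNE => Aoo.
suff add2e (e : {posnum R}) : lebesgue_outer (\bigcup_n A n) <=
    \sum_(i <oo) lebesgue_outer (A i) + e%:num%:E.
  by apply/lee_addgt0Pr => _/posnumP[].
rewrite (le_trans _ (epsilon_trick _ _ _))//; last first.
  by move=> n; exact: lebesgue_outer_ge0.
pose P n (F : set nat * (nat -> 'rV[R]_d * 'rV[R]_d)) := box_cover (A n) F /\
  \esum_(k in F.1) (box_volume (F.2 k))%:E
    <= lebesgue_outer (A n) + (e%:num / (2 ^ n.+1)%:R)%:E.
have [G PG] : {G & forall n, P n (G n)}.
  apply: (@choice _ _ P) => n; rewrite /P /lebesgue_outer.
  have := lebesgue_outer_ge0 (A n); have := Aoo n; rewrite /lebesgue_outer.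
  set S := [set _ | _ in _].
  case infS : (ereal_inf S) => [r| |] // _ _.
  have en1 : (0 < e%:num / (2 ^ n.+1)%:R)%R by [].
  have /(lb_ereal_inf_adherent en1) : ereal_inf S \is a fin_num by rewrite infS.
  move=> [_ [F AF <-] xS].
  by exists F; split => //; rewrite -infS; exact/ltW.
have /card_esym/ppcard_eqP[f] := card_nat2.
pose J := [set nk : nat * nat | (G nk.1).1 nk.2].
apply: (@le_trans _ _ (\esum_(i in [set: nat])
    \esum_(k in (G i).1) (box_volume ((G i).2 k))%:E)); last first.
  rewrite nneseries_esumT//; last first.
    by move=> n; apply: adde_ge0 => //; exact: lebesgue_outer_ge0.
  by apply: le_esum => n _; exact: (PG n).2.
rewrite esum_esum//.
rewrite (_ : setXR _ _ = J); last by apply/seteqP; split => [x []|x].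
apply: ereal_inf_lbound.
exists (f @^-1` J, fun m => (G (f m).1).2 (f m).2) => /=.
  move=> x [n _ /(PG n).1 [k Gk xk]].
  by exists (f^-1%FUN (n, k)); rewrite /J/= invK ?inE.
rewrite -(reindex_esum (f @^-1` J) J f
  (fun nk => (box_volume ((G nk.1).2 nk.2))%:E))//.
split=> [m//|m n _ _ fmn|x Jx].
  by apply: (@inj _ _ [set: nat] f) => //; rewrite inE.
by exists (f^-1%FUN x); rewrite /= ?invK ?inE.
Qed.

HB.instance Definition _ := isOuterMeasure.Build R 'rV[R]_d lebesgue_outer
  lebesgue_outer0 lebesgue_outer_ge0 le_lebesgue_outer
  lebesgue_outer_sigma_subadditive.

End lebesgue_outer.

Section lebesgue_measure_rV.
Context (R : realType) (d : nat).

Let outer : {outer_measure set 'rV[R]_d -> \bar R} := @lebesgue_outer R d.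

(* Lebesgue measure on R^d: the restriction of the outer measure to its
   Caratheodory measurable sets, i.e. to the Lebesgue measurable sets. The type
   lebesgue_rV is 'rV[R]_d with this (complete) sigma-algebra. *)
Definition lebesgue_rV := caratheodory_type outer.

HB.instance Definition _ := Measurable.on lebesgue_rV.

Definition mes : set lebesgue_rV -> \bar R := @lebesgue_outer R d.

HB.instance Definition _ := Measure.copy mes
  (outer : set (caratheodory_type outer) -> \bar R).

End lebesgue_measure_rV.

Arguments mes {R d}.

Section bounded_remainder.
Context (R : realType) (d : nat).
Implicit Types (alpha x : 'rV[R]_d) (S : set 'rV[R]_d).

Definition rat_free n (v : 'rV[R]_n) : Prop :=
  forall c : 'rV[rat]_n, \sum_(i < n) ratr (c ord0 i) * v ord0 i = 0 -> c = 0.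

Definition irrational_vector alpha : Prop :=
  rat_free (row_mx (const_mx 1 : 'rV[R]_1) alpha).

Definition integer_span alpha : set 'rV[R]_d :=
  [set v | exists (n : int) (m : 'rV[int]_d),
     v = n%:~R *: alpha + map_mx intr m].

(* For bounded S the sum has finitely many nonzero terms; it would default to 0
   if the support were infinite. *)
Definition chi S x : R :=
  \sum_(k \in [set: 'rV[int]_d]) (\1_S (x + map_mx intr k) : R).

(* The torus R^d / Z^d, with its Haar measure, is represented by its fundamental
   domain [0, 1[^d with Lebesgue measure; chi S is Z^d-periodic. *)
Definition unit_cube : set 'rV[R]_d :=
  [set x | forall i, 0 <= x ord0 i < 1].

Definition bounded_remainder_set alpha S : Prop :=
  [/\ bounded_set S, measurable (S : set (lebesgue_rV R d)) &
    exists C : R, forall n, (1 <= n)%N ->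
      {ae mes, forall x : lebesgue_rV R d, unit_cube x ->
        `|\sum_(k < n) chi S ((x : 'rV[R]_d) + alpha *+ k) -
          n%:R * fine (mes S)| <= C}].

Definition boundary S : set 'rV[R]_d := closure S `\` interior S.

Definition Riemann_measurable S : Prop :=
  bounded_set S /\ mes (boundary S) = 0%E.

End bounded_remainder.

(* Main.v *)
From HB Require Import structures.
Require Import Defs.
From mathcomp Require Import all_boot all_order all_algebra.
From mathcomp Require Import all_classical all_reals all_analysis.
From mathcomp Require Import measurable_realfun lra ring zify.

Set Implicit Arguments.
Unset Strict Implicit.
Unset Printing Implicit Defensive.

Import Order.TTheory GRing.Theory Num.Theory.
Import numFieldNormedType.Exports.

(** Write G_a for the group Z a + Z^d. A Birkhoff sum for the rotation by a counts
    lattice points: the sum up to time n of chi S at x is the number of (k, m) in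
    Z x Z^d with 0 <= k < n and x + k a + m in S. So S is a bounded remainder set
    exactly when these lattice points are spread along the time axis k with a
    bounded error.

    Assume that T maps G_alpha into G_beta. Then T lifts to an integer matrix A on
    Z^(1+d) (integer_span_matrix), injective since 1 and the coordinates of alpha are
    independent over Q, so the lattice is a finite union of cosets of the image of A
    (finite_coset_rep). As A carries the direction (1, -alpha) that projects to zero
    onto c (1, -beta) with c <> 0 (slope_neq0), the beta-time of mu A differs from
    c times the alpha-time of mu by a linear function of the projection of mu
    (first_coord), hence by a bounded amount, up to a translation, as long as that
    projection stays in a bounded set. Each coset thus contributes an alpha-Birkhoff
    sum of S over a time interval of length n / |c| + O(1), and the beta-Birkhoff sums
    of T S are n D + O(1) for some D (birkhoff_transfer). Integrating over a
    fundamental domain forces D = mes (T S) (density_eq_mes).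

    Conversely, let g be in G_alpha. Remove a small piece V from a far away integer
    translate of the fundamental box and put it back either at V or at V + g: both
    results are bounded remainder sets for alpha, because the sums telescope
    (bounded_remainder_set_exchanged). If T preserves bounded remainder sets, then for
    W = T V the beta-Birkhoff sums of W and of W + T g differ by a bounded amount
    (oscillation_bounded), and here W is any Riemann measurable set near some point.
    If T g were not in G_beta, a gliding hump would contradict this
    (oscillation_unbounded). Indeed the orbit of p returns to p + eps, p + 2 eps, ...,
    p + M eps with eps as small as desired, while its translate by - T g meets none of
    these points modulo Z^d; tiny boxes around them form a set whose two sums differ
    by at least M on an open set. Accumulating at p infinitely many such clusters, each one
    large compared with the bound that holds for the previous ones, gives a Riemann
    measurable W with unbounded difference.

    The measure theory behind this is elementary: the outer measure of a box is its
    volume (lebesgue_outer_box), linear maps preserve null sets (null_image), and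
    Riemann measurable sets are measurable. *)

Local Open Scope classical_set_scope.
Local Open Scope ring_scope.

(** * Boxes, translations and measurability *)

Section outer.
Context {R : realType} {d : nat}.
Implicit Types (A B X : set 'rV[R]_d) (v x : 'rV[R]_d) (ab : 'rV[R]_d * 'rV[R]_d).

Lemma lebesgue_outer_box_le ab : (lebesgue_outer (box ab) <= (box_volume ab)%:E)%E.
Proof.
apply: ereal_inf_lbound; exists ([set 0%N], fun=> ab) => /=.
  by move=> x abx; exists 0%N.
by rewrite esum_set1// lee_fin box_volume_ge0.
Qed.

Lemma le_lebesgue_outer_shift v A :
  (lebesgue_outer [set x | A (x + v)%R] <= lebesgue_outer A)%E.
Proof.
apply: ereal_inf_le_tmp => _ [F AF <-].
exists (F.1, fun k => ((F.2 k).1 - v, (F.2 k).2 - v)).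
  move=> x /= /AF [k Fk xk]; exists k => // i /=; have := xk i.
  by rewrite !mxE ltrBlDr lerBrDr.
apply: eq_esum => k _ /=; congr _%:E; apply: eq_bigr => i _ /=.
by rewrite !mxE opprD addrACA subrr addr0.
Qed.

Lemma lebesgue_outer_shift v A :
  lebesgue_outer [set x | A (x + v)%R] = lebesgue_outer A.
Proof.
apply/eqP; rewrite eq_le le_lebesgue_outer_shift/=.
rewrite [X in (X <= _)%E](_ : _ = lebesgue_outer [set x | A ((x - v) + v)%R]).
  exact: (le_lebesgue_outer_shift (- v) [set x | A (x + v)]).
by congr lebesgue_outer; apply/seteqP; split => x /=; rewrite subrK.
Qed.

(** True by unfolding; it exposes the Caratheodory condition behind the sigma-algebra. *)
Lemma measurable_lebesgue_rVP A :
  measurable (A : set (lebesgue_rV R d)) <-> (lebesgue_outer (d:=d)).-caratheodory A.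
Proof. by []. Qed.

Lemma measurable_shift v A : measurable (A : set (lebesgue_rV R d)) ->
  measurable ([set x | A (x + v)] : set (lebesgue_rV R d)).
Proof.
move=> /measurable_lebesgue_rVP mA; apply/measurable_lebesgue_rVP => X.
rewrite -(lebesgue_outer_shift (- v) X) (mA _).
rewrite -(lebesgue_outer_shift v (_ `&` A)) -(lebesgue_outer_shift v (_ `&` ~` A)).
by congr (_ + _)%E; congr lebesgue_outer;
  apply/seteqP; split => x /=; rewrite addrK.
Qed.

(** A hyperplane orthogonal to an axis cuts each box of a cover into two boxes whose
    volumes add up, which is the Caratheodory condition. *)
Lemma measurable_halfspace (i : 'I_d) (c : R) :
  measurable ([set x | x ord0 i <= c] : set (lebesgue_rV R d)).
Proof.
apply/measurable_lebesgue_rVP/le_caratheodory_measurable => X.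
apply: le_ereal_inf_tmp => _ [F XF <-].
pose lo ab : 'rV[R]_d * 'rV[R]_d :=
  (ab.1, \row_j if j == i then Num.min (ab.2 ord0 j) c else ab.2 ord0 j).
pose hi ab : 'rV[R]_d * 'rV[R]_d :=
  (\row_j if j == i then Num.max (ab.1 ord0 j) c else ab.1 ord0 j, ab.2).
apply: (@le_trans _ _ (\esum_(k in F.1) (box_volume (lo (F.2 k)))%:E +
    \esum_(k in F.1) (box_volume (hi (F.2 k)))%:E)%E).
  apply: leeD; apply: ereal_inf_lbound.
    exists (F.1, fun k => lo (F.2 k)) => //= x [/XF[k Fk xk] /= xc].
    exists k => // j; rewrite /= mxE; have := xk j.
    by case: eqP => [->|//] /andP[-> ?]; rewrite /= le_min xc andbT.
  exists (F.1, fun k => hi (F.2 k)) => //= x [/XF[k Fk xk] /= /negP].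
  rewrite -ltNge => xc.
  exists k => // j; rewrite /= mxE; have := xk j.
  by case: eqP => [->|//] /andP[? ->]; rewrite gt_max xc !andbT.
rewrite -esumD; last 2 first.
- by move=> k _; rewrite lee_fin box_volume_ge0.
- by move=> k _; rewrite lee_fin box_volume_ge0.
apply: le_esum => k _; rewrite -EFinD lee_fin.
rewrite /box_volume (bigD1 i)//= [X in _ + X](bigD1 i)//= [leRHS](bigD1 i)//=.
pose side j := Num.max 0 ((F.2 k).2 ord0 j - (F.2 k).1 ord0 j).
rewrite (eq_bigr side); last by move=> j /negbTE ji; rewrite mxE ji.
rewrite [X in _ + _ * X](eq_bigr side); last first.
  by move=> j /negbTE ji; rewrite mxE ji.
rewrite -mulrDl; apply: ler_wpM2r.
  by apply: prodr_ge0 => j _; rewrite le_max lexx.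
rewrite !mxE eqxx; move: (_ ord0 i) => b; move: (_ ord0 i) => a.
rewrite /Num.max /Num.min.
by repeat case: ifP; lra.
Qed.

Lemma measurable_box ab : measurable (box ab : set (lebesgue_rV R d)).
Proof.
rewrite (_ : box ab = \bigcap_(i in [set: 'I_d])
  ([set x | x ord0 i <= ab.2 ord0 i] `&` ~` [set x | x ord0 i <= ab.1 ord0 i])).
  apply: (@fin_bigcap_measurable _ (lebesgue_rV R d)); first exact: finite_finset.
  move=> i _; apply: (@measurableI _ (lebesgue_rV R d)); first exact: measurable_halfspace.
  by apply: (@measurableC _ (lebesgue_rV R d)); exact: measurable_halfspace.
apply/seteqP; split => x xab i; first move=> _.
  have /andP[] := xab i => a b; split => //=.
  by apply/negP; rewrite -ltNge.
by have [/= ->] := xab i I => /negP; rewrite -ltNge => ->.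
Qed.

(** Interpolates between the indicator function of the box (at m = d) and its volume
    (at m = 0): the coordinates from m on have been integrated out. *)
Definition partial_volume (m : nat) ab x : R :=
  \prod_(i < d) if (i < m)%N then \1_(`]ab.1 ord0 i, ab.2 ord0 i]%classic) (x ord0 i)
    else Num.max 0 (ab.2 ord0 i - ab.1 ord0 i).

Lemma partial_volume_ge0 m ab x : 0 <= partial_volume m ab x.
Proof.
by apply: prodr_ge0 => i _; case: ifP => _; rewrite ?indicE ?ler0n// le_max lexx.
Qed.

Lemma partial_volume0 ab x : partial_volume 0 ab x = box_volume ab.
Proof. exact: eq_bigr. Qed.

Let set_coord x (i : 'I_d) (t : R) : 'rV[R]_d :=
  \row_j if j == i then t else x ord0 j.

Lemma partial_volume_integral (m : 'I_d) ab x :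
  (\int[lebesgue_measure]_t
     (partial_volume m.+1 ab (set_coord x m t))%:E = (partial_volume m ab x)%:E)%E.
Proof.
pose c := \prod_(i < d | i != m) if (i < m)%N then
    \1_(`]ab.1 ord0 i, ab.2 ord0 i]%classic) (x ord0 i) : R
    else Num.max 0 (ab.2 ord0 i - ab.1 ord0 i).
have c0 : 0 <= c.
  by apply: prodr_ge0 => i _; case: ifP => _; rewrite ?indicE ?ler0n// le_max lexx.
transitivity (\int[lebesgue_measure]_t
    (c%:E * (\1_(`]ab.1 ord0 m, ab.2 ord0 m]%classic) t)%:E))%E.
  apply: eq_integral => t _; rewrite -EFinM /partial_volume (bigD1 m)//= leqnn !mxE eqxx mulrC.
  congr (_ * _)%:E; apply: eq_bigr => i im.
  by rewrite mxE (negbTE im) ltnS leq_eqVlt (_ : (i == m :> nat) = false)//; apply/negbTE.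
rewrite ge0_integralZl//; last by apply/measurable_EFinP; exact: measurable_indic.
rewrite integral_indic// setIT.
rewrite /partial_volume (bigD1 m)//= ltnn -/c mulrC EFinM; congr (_ * _)%E.
apply: etrans (lebesgue_measure_itv `]ab.1 ord0 m, ab.2 ord0 m]) _ => /=.
by rewrite lte_fin /Num.max subr_gt0; case: ifP.
Qed.

Lemma partial_volume_measurable (m : 'I_d) ab x :
  measurable_fun setT (fun t => (partial_volume m.+1 ab (set_coord x m t))%:E).
Proof.
apply/measurable_EFinP; rewrite /partial_volume.
apply: (measurable_prod (h := fun (i : 'I_d) t => if (i < m.+1)%N
  then \1_(`]ab.1 ord0 i, ab.2 ord0 i]%classic) ((set_coord x m t) ord0 i)
    else Num.max 0 (ab.2 ord0 i - ab.1 ord0 i))) => i _.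
have [im|im] := boolP (i < m.+1)%N; last exact: measurable_cst.
rewrite [X in measurable_fun _ X](_ : _ = fun t =>
    if i == m then \1_(`]ab.1 ord0 i, ab.2 ord0 i]%classic) t
    else \1_(`]ab.1 ord0 i, ab.2 ord0 i]%classic) (x ord0 i)); last first.
  by apply/funext => t; rewrite mxE; case: ifP.
by case: (i == m) => //; exact: measurable_indic.
Qed.

(** The indicator functions satisfy the corresponding pointwise inequality, as a point
    of the box lies in some box of the cover. Integrating it in one coordinate after
    the other, with monotone convergence for the sum over the cover, turns every
    indicator function into a volume. *)
Lemma box_volume_cover ab (F : nat -> 'rV[R]_d * 'rV[R]_d) (J : set nat) :
  box ab `<=` \bigcup_(k in J) box (F k) ->
  ((box_volume ab)%:E <= \esum_(k in J) (box_volume (F k))%:E)%E.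
Proof.
move=> abF.
(* integration commutes with series indexed by nat *)
have E (g : nat -> R) : (forall k, 0 <= g k) -> \esum_(k in J) (g k)%:E =
    (\sum_(k <oo) ((\1_J k) * g k)%:E)%E.
  move=> g0; rewrite nneseries_esumT; last first.
    by move=> k; rewrite lee_fin mulr_ge0// indicE ler0n.
  rewrite esum_mkcond; apply: eq_esum => k _; rewrite indicE.
  by case: ifP => _; rewrite ?mul1r ?mul0r.
have : forall m, (m <= d)%N -> forall x, ((partial_volume (d - m) ab x)%:E <=
    \esum_(k in J) (partial_volume (d - m) (F k) x)%:E)%E; last first.
  move=> /(_ d (leqnn _) 0); rewrite subnn partial_volume0 => /le_trans; apply.
  by apply: le_esum => k _; rewrite partial_volume0.
have box1 cd x : partial_volume d cd x = (x \in box cd)%:R.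
  rewrite /partial_volume; under eq_bigr do rewrite ltn_ord indicE.
  have [xi|xi] := boolP (x \in box cd).
    move: xi; rewrite inE => xi; rewrite big1// => i _.
    by rewrite mem_set//= in_itv/=; exact: xi.
  have /existsNP[i xNi] : ~ box cd x by move=> /mem_set; exact/negP.
  by rewrite (bigD1 i)//= memNset ?mul0r//= in_itv.
elim=> [_ x|m IH md x].
  rewrite subn0 box1; have [|_] := boolP (x \in box ab); last first.
    by apply: esum_ge0 => k _; rewrite lee_fin partial_volume_ge0.
  rewrite inE => /abF [k Jk xk]; apply: esum_ge; exists [set k].
    by split => // _ ->.
  by rewrite fsbig_set1 box1 mem_set.
have dm : (d - m.+1 < d)%N by rewrite ltn_subrL (leq_trans _ md).
pose i := Ordinal dm.
have Si : (d - m)%N = i.+1 by rewrite /= subnSK.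
rewrite -/(nat_of_ord i) -(partial_volume_integral i).
rewrite E; last by move=> k; exact: partial_volume_ge0.
rewrite (eq_eseriesr (g := fun k => \int[lebesgue_measure]_t
   (\1_J k * partial_volume i.+1 (F k) (set_coord x i t))%:E)%E); last first.
  move=> k _; under eq_integral do rewrite EFinM.
  rewrite ge0_integralZl//.
  - by rewrite partial_volume_integral EFinM.
  - exact: partial_volume_measurable.
  - by move=> t _; rewrite lee_fin partial_volume_ge0.
have g0 (k : nat) t : (0 <= (\1_J k * partial_volume i.+1 (F k) (set_coord x i t))%:E)%E.
  by rewrite lee_fin mulr_ge0 ?partial_volume_ge0// indicE ler0n.
have mg k : measurable_fun setT
    (fun t => (\1_J k * partial_volume i.+1 (F k) (set_coord x i t))%:E).
  under eq_fun do rewrite EFinM.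
  apply: emeasurable_funM; first exact: measurable_cst.
  exact: partial_volume_measurable.
rewrite -(@integral_nneseries _ _ _ lebesgue_measure setT measurableT)//.
apply: ge0_le_integral => //.
- by move=> t _; rewrite lee_fin partial_volume_ge0.
- exact: partial_volume_measurable.
- have := ge0_emeasurable_sum (P := xpredT) (D := setT) (fun k t _ _ => g0 k t) (fun k _ => mg k).
  exact.
move=> t _; rewrite -E; last by move=> k; exact: partial_volume_ge0.
by rewrite -Si; exact: IH (ltnW md) _.
Qed.

Lemma lebesgue_outer_box ab : lebesgue_outer (box ab) = (box_volume ab)%:E.
Proof.
apply/eqP; rewrite eq_le lebesgue_outer_box_le/=.
by apply: le_ereal_inf_tmp => _ [F abF <-]; exact: box_volume_cover.
Qed.

End outer.

(** * Null sets *)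

Section null_sets.
Context {R : realType} {d : nat}.
Implicit Types (A B X : set 'rV[R]_d) (v x : 'rV[R]_d) (ab : 'rV[R]_d * 'rV[R]_d).

Definition null A := lebesgue_outer A = 0%E.

Lemma null_le_eps A : (forall e, 0 < e -> (lebesgue_outer A <= e%:E)%E) -> null A.
Proof.
move=> Ae; apply/eqP; rewrite eq_le lebesgue_outer_ge0 andbT.
by apply/lee_addgt0Pr => e e0; rewrite add0e Ae.
Qed.

Lemma null_sub A B : A `<=` B -> null B -> null A.
Proof.
move=> AB B0; apply/eqP; rewrite eq_le lebesgue_outer_ge0 andbT -B0.
exact: le_lebesgue_outer.
Qed.

Lemma null0 : null set0. Proof. exact: lebesgue_outer0. Qed.

Lemma null_bigcup (F : nat -> set 'rV[R]_d) :
  (forall n, null (F n)) -> null (\bigcup_n F n).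
Proof.
move=> F0; apply/eqP; rewrite eq_le lebesgue_outer_ge0 andbT.
apply: le_trans (lebesgue_outer_sigma_subadditive F) _.
by rewrite eseries0// => n _ _; exact: F0.
Qed.

Lemma null_bigcup_countable (I : countType) (F : I -> set 'rV[R]_d) :
  (forall i, null (F i)) -> null (\bigcup_i F i).
Proof.
move=> F0; apply: (@null_sub _ (\bigcup_n if unpickle n is Some i then F i else set0)).
  by move=> x [i _ Fix]; exists (pickle i); rewrite ?pickleK.
by apply: null_bigcup => n; case: unpickle => // _; exact: null0.
Qed.

Lemma nullU A B : null A -> null B -> null (A `|` B).
Proof.
move=> A0 B0; apply: (@null_sub _ (\bigcup_(b : bool) if b then A else B)).
  by move=> x [?|?]; [exists true|exists false].
by apply: null_bigcup_countable => -[].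
Qed.

Lemma null_measurable A : null A -> measurable (A : set (lebesgue_rV R d)).
Proof.
move=> A0; apply/measurable_lebesgue_rVP/le_caratheodory_measurable => X.
change (lebesgue_outer (X `&` A) + lebesgue_outer (X `&` ~` A) <= lebesgue_outer X)%E.
rewrite (_ : lebesgue_outer (X `&` A) = 0%E); last first.
  by apply: (@null_sub _ A) => //; apply: subIsetr.
by rewrite add0e; apply: le_lebesgue_outer; apply: subIsetl.
Qed.

Lemma negligible_mesP A :
  (mes (R := R) (d := d)).-negligible (A : set (lebesgue_rV R d)) <-> null A.
Proof.
split=> [[B [mB B0 AB]]|A0]; first exact: (@null_sub _ B).
by exists A; split => //; exact: null_measurable.
Qed.

Lemma ae_mesP (P : 'rV[R]_d -> Prop) :
  {ae mes, forall x : lebesgue_rV R d, P x} <-> null [set x | ~ P x].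
Proof. exact: negligible_mesP. Qed.

Lemma null_shift v A : null A -> null [set x | A (x + v)].
Proof. by rewrite /null lebesgue_outer_shift. Qed.

Lemma not_null_cube x e : 0 < e ->
  ~ null [set y : 'rV[R]_d | forall i, `|y ord0 i - x ord0 i| < e].
Proof.
move=> e0 N; pose ab : 'rV[R]_d * 'rV[R]_d :=
  (\row_i (x ord0 i - e / 2), \row_i (x ord0 i + e / 2)).
have : null (box ab).
  apply: null_sub N => y yab i; have := yab i; rewrite !mxE /= => /andP[y1 y2].
  by rewrite ltr_distl; lra.
rewrite /null lebesgue_outer_box => -[] /eqP; apply/negP.
apply/prodf_neq0 => i _ /=; rewrite !mxE gt_eqF// lt_max; lra.
Qed.

(** A bounded part of the hyperplane fits in a box with one side of arbitrarily small
    length and the others fixed. *)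
Lemma null_hyperplane (i : 'I_d) (c : R) : null [set x | x ord0 i = c].
Proof.
(* the part of the hyperplane in the cube of side 2 K *)
pose C (K : nat) : set 'rV[R]_d := [set x | x ord0 i = c /\ forall j, `|x ord0 j| < K%:R].
apply: (@null_sub _ (\bigcup_K C K)).
  move=> x /= xc; exists (Num.truncn (\sum_j `|x ord0 j|)).+1 => //; split => // j.
  apply: le_lt_trans (truncnS_gt _).
  by rewrite (bigD1 j)//= lerDl sumr_ge0.
apply: null_bigcup => K; apply: null_le_eps => e e0.
pose p := \prod_(j < d | j != i) (K%:R + K%:R : R).
have p0 : 0 <= p by apply: prodr_ge0.
pose h := e / (p + 1); have h0 : 0 < h by rewrite divr_gt0//; lra.
pose ab : 'rV[R]_d * 'rV[R]_d :=
  (\row_j if j == i then c - h else - K%:R, \row_j if j == i then c else K%:R).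
apply: (@le_trans _ _ (lebesgue_outer (box ab))).
  apply: le_lebesgue_outer => x [xc xK] j; rewrite !mxE/=.
  case: eqP => [->|_]; first by rewrite xc; lra.
  by have := xK j; rewrite ltr_norml => /andP[-> /ltW].
rewrite lebesgue_outer_box lee_fin /box_volume (bigD1 i)//= !mxE eqxx.
rewrite (eq_bigr (fun=> K%:R + K%:R)); last first.
  by move=> j /negbTE ji; rewrite !mxE ji opprK max_r.
rewrite -/p opprB addrCA subrr addr0 max_r; last exact: ltW.
rewrite /h mulrAC ler_pdivrMr; last lra.
by rewrite ler_pM2l//; lra.
Qed.

End null_sets.

(** * Linear maps preserve null sets *)

Section linear_images.
Context {R : realType} {d : nat}.
Implicit Types (A B X : set 'rV[R]_d) (v x : 'rV[R]_d) (ab : 'rV[R]_d * 'rV[R]_d).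
Variable T : {linear 'rV[R]_d -> 'rV[R]_d}.

(** The strict inequality is what places images of cubes in half-open boxes. *)
Lemma linear_bound : exists2 L, 0 < L & forall e v, 0 < e ->
  (forall j, `|v ord0 j| <= e) -> forall i, `|T v ord0 i| < L * e.
Proof.
exists (1 + \sum_(i < d) \sum_(j < d) `|lin1_mx T j i|).
  by apply: ltr_wpDr => //; do 2!apply: sumr_ge0 => ? _.
move=> e v e0 ve i; rewrite -mul_rV_lin1 mxE.
apply: le_lt_trans (ler_norm_sum _ _ _) _.
apply: (@le_lt_trans _ _ ((\sum_(j < d) `|lin1_mx T j i|) * e)).
  rewrite mulr_suml; apply: ler_sum => j _; rewrite normrM mulrC.
  by rewrite ler_wpM2l.
rewrite ltr_pM2r// [ltRHS](_ : _ = 1 + (\sum_(j < d) `|lin1_mx T j i| +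
  \sum_(k < d | k != i) \sum_(j < d) `|lin1_mx T j k|)); last by rewrite (bigD1 i).
rewrite addrCA ltrDl ltr_wpDr//.
by do 2!apply: sumr_ge0 => ? _.
Qed.

Lemma lebesgue_outer_bigsetU (I : Type) (s : seq I) (P : pred I) (F : I -> set 'rV[R]_d) :
  (lebesgue_outer (\big[setU/set0]_(i <- s | P i) F i) <=
   \sum_(i <- s | P i) lebesgue_outer (F i))%E.
Proof.
elim/big_ind2 : _ => //; first by rewrite lebesgue_outer0.
move=> A a B b Aa Bb; apply: le_trans (outer_measureU2 _ _ _) _.
exact: leeD.
Qed.

(** The image of a cube of side h lies in a cube of side 2 L h, so cubes are harmless. A
    box whose sides l_i are all at least 1/n is covered by at most \prod_i (2 n l_i)
    cubes of side 1/n, and the powers of n cancel. *)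
Lemma lebesgue_outer_linear_box : exists2 C : R, 0 < C &
  forall ab, (lebesgue_outer (T @` box ab) <= (C * box_volume ab)%:E)%E.
Proof.
have [L L0 TL] := linear_bound; exists ((4 * L) ^+ d).
  by rewrite exprn_gt0// mulr_gt0.
move=> ab; pose l i := ab.2 ord0 i - ab.1 ord0 i.
have [lpos|] := pselect (forall i, 0 < l i); last first.
  move=> /existsNP[i /negP]; rewrite -leNgt => li.
  rewrite (_ : _ @` _ = set0).
    by rewrite lebesgue_outer0 lee_fin mulr_ge0 ?box_volume_ge0// exprn_ge0// mulr_ge0// ltW.
  apply/seteqP; split => // y [x xab _]; have := xab i; rewrite /l in li; lra.
(* the sum bounds every 1 / l_i, which makes all sides at least 1/n *)
pose n := (Num.truncn (\sum_i (l i)^-1)).+1.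
have n0 : 0 < n%:R :> R by rewrite ltr0n.
have nl i : 1 <= l i * n%:R.
  rewrite mulrC -ler_pdivrMr// mul1r; apply: ltW; apply: le_lt_trans (truncnS_gt _).
  by rewrite (bigD1 i)//= lerDl sumr_ge0// => j _; rewrite invr_ge0 ltW.
pose m i := (Num.truncn (l i * n%:R)).+1.
have mle i : (m i)%:R <= 2 * (l i * n%:R).
  rewrite /m -addn1 natrD.
  have := @truncn_le R (l i * n%:R); rewrite (_ : (0 <= _) = true); last first.
    by rewrite mulr_ge0// ?ltW.
  by have := nl i; lra.
pose N := (\max_i m i).+1.
pose Q i := [pred j : 'I_N | (j < m i)%N].
(* the corner of the small cube indexed by f *)
pose c (f : {ffun 'I_d -> 'I_N}) : 'rV[R]_d := \row_i (ab.1 ord0 i + (f i)%:R / n%:R).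
pose h := L * n%:R^-1.
pose cube f : 'rV[R]_d * 'rV[R]_d :=
  (\row_i (T (c f) ord0 i - h), \row_i (T (c f) ord0 i + h)).
apply: (@le_trans _ _ (lebesgue_outer (\big[setU/set0]_(f in family Q) box (cube f)))).
  apply: le_lebesgue_outer => _ [x xab <-].
  have zm i : (Num.truncn ((x ord0 i - ab.1 ord0 i) * n%:R) < m i)%N.
    rewrite ltnS; apply: le_truncn; rewrite ler_pM2r// lerB//.
    by have /andP[] := xab i.
  have zN i : (Num.truncn ((x ord0 i - ab.1 ord0 i) * n%:R) < N)%N.
    by apply: leq_trans (zm i) _; apply: leqW; exact: leq_bigmax.
  pose f := [ffun i => Ordinal (zN i)].
  have fQ : f \in family Q by apply/familyP => i; rewrite ffunE inE; exact: zm.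
  rewrite (bigD1 f)//=; left => i; rewrite !mxE /=.
  have : `|T (x - c f) ord0 i| < h.
    apply: TL => [|j]; first by rewrite invr_gt0.
    rewrite !mxE ffunE /=; set z := Num.truncn _.
    have /truncn_itv : 0 <= (x ord0 j - ab.1 ord0 j) * n%:R.
      by rewrite mulr_ge0 ?ltW// subr_gt0; have /andP[] := xab j.
    rewrite -/z -[z.+1]addn1 natrD => /andP[z1 z2].
    move: z1 z2; rewrite -ler_pdivrMr// -ltr_pdivlMr// mulrDl mul1r => z1 z2.
    have n1 : 0 < n%:R^-1 :> R by rewrite invr_gt0.
    by rewrite ler_norml; apply/andP; split; lra.
  rewrite linearB !mxE ltr_norml => /andP[Tl Tr].
  by apply/andP; split; lra.
apply: le_trans (lebesgue_outer_bigsetU _ _ _) _.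
rewrite (eq_bigr (fun=> (\prod_(i < d) (h + h))%:E)); last first.
  move=> f _; rewrite lebesgue_outer_box; congr _%:E; apply: eq_bigr => i _.
  by rewrite !mxE opprB addrACA addrC addrA addrNK max_r// addr_ge0// /h mulr_ge0 ?ltW// invr_gt0.
rewrite sumEFin lee_fin.
rewrite -(bigA_distr_big_dep Q (fun _ _ => h + h)) /box_volume.
rewrite -[d in X in X * _]card_ord -prodr_const -big_split/=.
apply: ler_prod => i _.
rewrite -(big_ord_widen N (fun=> h + h)); last by apply: leqW; exact: leq_bigmax.
rewrite sumr_const card_ord -[(h + h) *+ _]mulr_natr.
have h0 : 0 < h by rewrite /h divr_gt0.
apply/andP; split; first by rewrite mulr_ge0 ?addr_ge0 ?ltW.
have -> : Num.max 0 (ab.2 ord0 i - ab.1 ord0 i) = l i by rewrite max_r// ltW// lpos.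
have nN : n%:R * n%:R^-1 = 1 :> R by rewrite mulfV// gt_eqF.
apply: (@le_trans _ _ ((h + h) * (2 * (l i * n%:R)))).
  by rewrite ler_pM2l ?addr_gt0.
have aux (p q r s : R) : r * s = 1 -> (p * s + p * s) * (2 * (q * r)) = 4 * p * q.
  by move=> rs; rewrite -[RHS]mulr1 -rs; ring.
by rewrite /h (aux _ _ _ _ nN).
Qed.

Lemma null_image A : null A -> null (T @` A).
Proof.
move=> A0; have [C C0 TC] := lebesgue_outer_linear_box; apply: null_le_eps => e e0.
have eC : 0 < e / C by rewrite divr_gt0.
have A_fin : lebesgue_outer A \is a fin_num by rewrite A0.
have := lb_ereal_inf_adherent eC A_fin; rewrite [ereal_inf _]A0.
move=> [_ [F AF <-] Fe].
pose g k := if k \in F.1 then (box_volume (F.2 k))%:E else 0%E.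
have g0 k : (0 <= g k)%E by rewrite /g; case: ifP => // _; rewrite lee_fin box_volume_ge0.
rewrite add0e esum_mkcond -nneseries_esumT// in Fe.
pose G k := if k \in F.1 then T @` box (F.2 k) else set0.
apply: (@le_trans _ _ (lebesgue_outer (\bigcup_k G k))).
  apply: le_lebesgue_outer => _ [x /AF[k Fk xk] <-]; exists k => //.
  by rewrite /G mem_set//; exists x.
apply: le_trans (lebesgue_outer_sigma_subadditive G) _.
apply: (@le_trans _ _ (\sum_(k <oo) (C%:E * g k))%E).
  apply: lee_nneseries => k *; first exact: lebesgue_outer_ge0.
  rewrite /G /g; case: ifP => _; last by rewrite mule0 lebesgue_outer0.
  by rewrite -EFinM.
rewrite nneseriesZl//; apply: (@le_trans _ _ (C%:E * (e / C)%:E)%E).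
  by rewrite lee_pmul2l// ltW.
by rewrite -EFinM mulrC divfK// gt_eqF.
Qed.

End linear_images.

(** * Riemann measurable sets *)

Section riemann.
Context {R : realType} {d : nat}.
Implicit Types (A B S : set 'rV[R]_d) (v x : 'rV[R]_d) (ab : 'rV[R]_d * 'rV[R]_d).

Lemma ler_coord_norm x i : `|x ord0 i| <= `|x|.
Proof.
rewrite [leRHS]/Num.norm /= mx_normrE.
by apply: (@le_bigmax _ _ _ _ (fun ij : 'I_1 * 'I_d => `|x ij.1 ij.2|) (ord0, i)).
Qed.

Lemma norm_le_coord x M : 0 <= M -> (forall i, `|x ord0 i| <= M) -> `|x| <= M.
Proof.
move=> M0 xM; rewrite /Num.norm /= mx_normrE; apply/bigmax_leP; split => // -[j i] _ /=.
by rewrite (ord1 j).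
Qed.

Lemma bounded_setP A :
  bounded_set A <-> exists2 M : R, 0 < M & forall x, A x -> forall i, `|x ord0 i| <= M.
Proof.
split=> [[M [_ AM]]|[M M0 AM]].
  exists (Num.max M 0 + 1); first by rewrite ltr_pwDr// le_max lexx orbT.
  move=> x Ax i; apply: le_trans (ler_coord_norm x i) _; apply: AM => //.
  by rewrite (@le_lt_trans _ _ (Num.max M 0)) ?le_max ?lexx// ltrDl.
exists M; split; first exact: num_real.
move=> N MN x Ax; apply: norm_le_coord; first by apply: ltW; exact: lt_trans MN.
by move=> i; apply: le_trans (AM x Ax i) _; exact: ltW.
Qed.

Lemma nbhs_rVP x A : nbhs x A <->
  exists2 e : R, 0 < e & forall y : 'rV[R]_d, (forall i, `|y ord0 i - x ord0 i| < e) -> A y.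
Proof.
split=> [/nbhs_ballP [e e0 xA]|[e e0 xA]].
  exists e => // y yx; apply: xA; split => // i j.
  by rewrite (ord1 i) -ball_normE /= distrC; exact: yx.
apply/nbhs_ballP; exists e => // y [_ xy]; apply: xA => i.
by have := xy ord0 i; rewrite -ball_normE /= distrC.
Qed.

(** An open set is the union of the boxes with rational vertices that it contains. *)
Lemma open_measurable_rV A : open A -> measurable (A : set (lebesgue_rV R d)).
Proof.
move=> oA; pose r (q : 'rV[rat]_d) : 'rV[R]_d := map_mx ratr q.
pose F (q : 'rV[rat]_d * 'rV[rat]_d) : set 'rV[R]_d :=
  if `[< box (r q.1, r q.2) `<=` A >] then box (r q.1, r q.2) else set0.
have mF q : measurable (F q : set (lebesgue_rV R d)).
  by rewrite /F; case: ifP => _; [exact: measurable_box|exact: measurable0].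
rewrite (_ : A = \bigcup_n (if unpickle n is Some q then F q else set0)).
  apply: (@bigcup_measurable _ (lebesgue_rV R d)) => n _.
  by case: unpickle => [q|]; [exact: mF|exact: measurable0].
apply/seteqP; split => x; last first.
  move=> [n _]; case: unpickle => // q; rewrite /F.
  by case: ifP => // /asboolP; exact.
move=> Ax; have /nbhs_rVP[e e0 xA] : nbhs x A by apply: open_nbhs_nbhs.
have rl i : exists p : rat, x ord0 i - e < ratr p < x ord0 i.
  have [|p] := @rat_in_itvoo R (x ord0 i - e) (x ord0 i); first by lra.
  by rewrite in_itv; exists p.
have rr i : exists p : rat, x ord0 i < ratr p < x ord0 i + e.
  have [|p] := @rat_in_itvoo R (x ord0 i) (x ord0 i + e); first by lra.
  by rewrite in_itv; exists p.
have [pl pl_] := choice rl; have [pr pr_] := choice rr.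
pose q := (\row_i pl i, \row_i pr i).
have qA : box (r q.1, r q.2) `<=` A.
  move=> y yq; apply: xA => i; have := yq i; rewrite !mxE /=.
  have /andP[] := pl_ i; have /andP[] := pr_ i => *.
  by rewrite ltr_distl; lra.
exists (pickle q) => //; rewrite pickleK /F asboolT// => i; rewrite !mxE/=.
by have /andP[_ ->] := pl_ i; have /andP[/ltW-> _] := pr_ i.
Qed.

(** Such a set is its interior together with part of its boundary. *)
Lemma Riemann_measurable_measurable S :
  Riemann_measurable S -> measurable (S : set (lebesgue_rV R d)).
Proof.
move=> [_ S0]; rewrite (_ : S = interior S `|` (S `\` interior S)); last first.
  by rewrite setUDr setDv setD0 setUidr//; exact: interior_subset.
apply: (@measurableU _ (lebesgue_rV R d)); first exact/open_measurable_rV/open_interior.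
apply: null_measurable; apply: null_sub S0 => x [Sx nSx]; split => //.
exact: subset_closure.
Qed.

Lemma boundaryU A B : boundary (A `|` B) `<=` boundary A `|` boundary B.
Proof.
move=> x; rewrite /boundary closureU => -[[cA|cB] nAB]; [left|right]; split => // i;
  apply: nAB; move: i; apply: interiorS => y; by [left|right].
Qed.

Lemma boundaryD A B : boundary (A `\` B) `<=` boundary A `|` boundary B.
Proof.
move=> x [cAB nAB].
have cA : closure A x by move: cAB; apply: closure_subset => y [].
have [iA|niA] := pselect (interior A x); last by left; split.
right; split.
  move=> U xU; apply: contrapT => BU; apply: nAB.
  apply: filterS (filterI iA xU) => y [Ay Uy]; split => // By.
  by apply: BU; exists y.
by move=> iB; have [y [[Ay nBy] By]] := cAB _ iB; apply: nBy.
Qed.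

(** The boundary lies on the hyperplanes that carry the faces. *)
Lemma boundary_box_null ab : null (boundary (box ab)).
Proof.
apply: (@null_sub _ _ _ (\bigcup_i [set x | x ord0 i = ab.1 ord0 i] `|`
    \bigcup_i [set x | x ord0 i = ab.2 ord0 i])); last first.
  by apply: nullU; apply: null_bigcup_countable => i; exact: null_hyperplane.
move=> x [cx nx]; apply: contrapT => /not_orP[n1 n2]; apply: nx.
have ge1 i : ab.1 ord0 i <= x ord0 i.
  rewrite leNgt; apply/negP => xi.
  have [|y [yab /= /(_ i)]] := cx [set y : 'rV[R]_d |
      forall k, `|y ord0 k - x ord0 k| < ab.1 ord0 i - x ord0 i].
    by apply/nbhs_rVP; exists (ab.1 ord0 i - x ord0 i); rewrite ?subr_gt0.
  by rewrite ltr_norml; have /andP[] := yab i; lra.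
have le2 i : x ord0 i <= ab.2 ord0 i.
  rewrite leNgt; apply/negP => xi.
  have [|y [yab /= /(_ i)]] := cx [set y : 'rV[R]_d |
      forall k, `|y ord0 k - x ord0 k| < x ord0 i - ab.2 ord0 i].
    by apply/nbhs_rVP; exists (x ord0 i - ab.2 ord0 i); rewrite ?subr_gt0.
  by rewrite ltr_norml; have /andP[] := yab i; lra.
(* neighbourhoods of matrices are products of neighbourhoods of the entries *)
exists (fun _ j => `]ab.1 ord0 j, ab.2 ord0 j[%classic).
  move=> i j; rewrite (ord1 i); apply: near_in_itvoo; rewrite in_itv/=.
  rewrite !lt_neqAle ge1 le2 !andbT; apply/andP; split.
    by apply/eqP => E; apply: n1; exists j.
  by apply/eqP => E; apply: n2; exists j.
by move=> y yab i; have := yab ord0 i; rewrite /= in_itv/= => /andP[-> /ltW].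
Qed.

Lemma continuous_linear_rV (T : {linear 'rV[R]_d -> 'rV[R]_d}) : continuous T.
Proof.
move=> x A /nbhs_rVP[e e0 TA]; have [L L0 TL] := linear_bound T.
have eL : 0 < e / L by rewrite divr_gt0.
have LeL : L * (e / L) = e by rewrite mulrC divfK// gt_eqF.
apply/nbhs_rVP; exists (e / L) => // y yx; apply: TA => i.
have := TL (e / L) (y - x) eL _ i; rewrite linearB LeL !mxE; apply => j.
by rewrite !mxE ltW.
Qed.

Lemma boundary_preimage (f : 'rV[R]_d -> 'rV[R]_d) A : continuous f ->
  boundary (f @^-1` A) `<=` f @^-1` boundary A.
Proof.
move=> cf x [cx nx]; split.
  by move=> U /cf /cx [y [Ay Uy]]; exists (f y).
by move=> iA; apply: nx; exact: cf iA.
Qed.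

Lemma Riemann_measurable_box ab : Riemann_measurable (box ab).
Proof.
split; last exact: boundary_box_null.
apply/bounded_setP; exists (1 + \sum_i (`|ab.1 ord0 i| + `|ab.2 ord0 i|)).
  by apply: ltr_wpDr => //; apply: sumr_ge0 => i _; rewrite addr_ge0.
move=> x xab i; rewrite (bigD1 i)//=; have /andP[] := xab i.
have : 0 <= \sum_(j < d | j != i) (`|ab.1 ord0 j| + `|ab.2 ord0 j|).
  by apply: sumr_ge0 => j _; rewrite addr_ge0.
have := ler_norm (ab.2 ord0 i); have := ler_norm (- ab.1 ord0 i); rewrite normrN.
have := normr_ge0 (ab.2 ord0 i); have := normr_ge0 (ab.1 ord0 i).
by rewrite ler_norml => *; apply/andP; split; lra.
Qed.

Lemma Riemann_measurableU A B : Riemann_measurable A -> Riemann_measurable B ->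
  Riemann_measurable (A `|` B).
Proof.
move=> [bA A0] [bB B0]; split; last exact: null_sub (@boundaryU A B) (nullU A0 B0).
move: bA bB => /bounded_setP[M M0 AM] /bounded_setP[N N0 BN].
apply/bounded_setP; exists (M + N); first exact: addr_gt0.
move=> x [/AM|/BN] xM i; apply: le_trans (xM i) _; [rewrite lerDl|rewrite lerDr]; exact: ltW.
Qed.

Lemma Riemann_measurableD A B : Riemann_measurable A -> Riemann_measurable B ->
  Riemann_measurable (A `\` B).
Proof.
move=> [bA A0] [bB B0]; split; last exact: null_sub (@boundaryD A B) (nullU A0 B0).
move: bA => /bounded_setP[M M0 AM].
by apply/bounded_setP; exists M => // x [/AM].
Qed.

Lemma Riemann_measurable0 : Riemann_measurable (set0 : set 'rV[R]_d).
Proof.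
by rewrite -(setDv (box (0, 0))); apply: Riemann_measurableD; exact: Riemann_measurable_box.
Qed.

Lemma bounded_set_shift v A : bounded_set A -> bounded_set [set x | A (x + v)].
Proof.
move=> /bounded_setP[M M0 AM]; apply/bounded_setP; exists (M + `|v|).
  by rewrite ltr_wpDr.
move=> x /AM xM i; rewrite -[x ord0 i](addrK (v ord0 i)).
apply: le_trans (ler_normB _ _) _; apply: lerD (ler_coord_norm _ _).
by have := xM i; rewrite mxE.
Qed.

Lemma Riemann_measurable_shift v A : Riemann_measurable A ->
  Riemann_measurable [set x | A (x + v)].
Proof.
move=> [bA A0]; split; first exact: bounded_set_shift.
have := null_shift v A0; apply: null_sub.
apply: (@boundary_preimage (fun x => x + v)) => x B /nbhs_rVP[e e0 xB].
apply/nbhs_rVP; exists e => // y yx; apply: xB => i.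
by rewrite !mxE opprD addrACA subrr addr0.
Qed.

Lemma linear_inverse (T : {linear 'rV[R]_d -> 'rV[R]_d}) : bijective T ->
  exists U : {linear 'rV[R]_d -> 'rV[R]_d}, cancel T U /\ cancel U T.
Proof.
move=> [f Tf fT].
pose fm := GRing.isZmodMorphism.Build _ _ f (can2_zmod_morphism Tf fT).
pose fs := GRing.isScalable.Build _ _ _ _ f (GRing.can2_scalable Tf fT).
pose U : {linear _ -> _} := HB.pack f fm fs.
by exists U.
Qed.

Lemma Riemann_measurable_linear (T U : {linear 'rV[R]_d -> 'rV[R]_d}) A :
  cancel T U -> cancel U T -> Riemann_measurable A -> Riemann_measurable (T @^-1` A).
Proof.
move=> TU UT [/bounded_setP[M M0 AM] A0]; have [L L0 UL] := linear_bound U; split.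
  apply/bounded_setP; exists (L * M); first exact: mulr_gt0.
  by move=> x /AM TxM i; rewrite -[x]TU; apply: ltW; exact: UL.
apply: null_sub (boundary_preimage (@continuous_linear_rV T)) _.
by apply: null_sub (null_image U A0) => x Tx; exists (T x).
Qed.

End riemann.

(** * The periodization of an indicator function *)

Section chi_theory.
Context {R : realType} {d : nat}.
Implicit Types (A B S : set 'rV[R]_d) (v x : 'rV[R]_d) (k m : 'rV[int]_d).

Local Notation zvec k := (map_mx intr k : 'rV[R]_d).

Lemma finite_zvec (M : R) : finite_set [set k | forall i, `|zvec k ord0 i| <= M].
Proof.
pose N := Num.truncn M.
pose h (f : 'rV['I_(N.*2.+1)]_d) : 'rV[int]_d := \row_i ((f ord0 i : nat)%:Z - N%:Z).
apply: (@sub_finite_set _ _ (h @` setT)); last by apply: finite_image; exact: finite_finset.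
move=> k kM; have kN i : (absz (k ord0 i) <= N)%N.
  have := kM i; rewrite mxE => kiM.
  by rewrite /N truncn_ge_nat ?natr_absz ?intr_norm// (le_trans _ kiM).
exists (\row_i inord (absz (k ord0 i + N%:Z))) => //; apply/rowP => i; rewrite !mxE.
have := kN i => kNi; rewrite inordK; last by rewrite ltnS -addnn; lia.
by rewrite gez0_abs ?addrK//; lia.
Qed.

Lemma finite_chi_support S x : bounded_set S -> finite_set [set k | S (x + zvec k)].
Proof.
move=> /bounded_setP[M M0 SM]; apply: sub_finite_set (finite_zvec (M + `|x|)) => k /SM Sk i.
rewrite -[zvec k](addKr x) mxE; apply: le_trans (ler_normD _ _) _.
rewrite addrC; apply: lerD; first exact: Sk.
by rewrite mxE normrN ler_coord_norm.
Qed.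

(** Infinite sums of nonnegative terms can be split and reindexed without checking
    finiteness, so most computations with [chi] go through this form. *)
Lemma chi_esum S x : bounded_set S ->
  (chi S x)%:E = \esum_(k in [set: 'rV[int]_d]) (\1_S (x + zvec k))%:E.
Proof.
move=> bS; have fS := finite_chi_support x bS.
have ge0 k : (0 <= (\1_S (x + zvec k) : R)%:E)%E by rewrite lee_fin indicE ler0n.
rewrite (esumID [set k | S (x + zvec k)])// setTI [X in (_ + X)%E]esum1; last first.
  by move=> k [_ /= nS]; rewrite indicE memNset.
rewrite adde0 esum_fset//= fsumEFin//; congr _%:E.
by apply/esym/fsbig_widen => // k [_ /= nS]; rewrite /= indicE memNset.
Qed.

Lemma chi_ge0 S x : 0 <= chi S x.
Proof. by apply: fsumr_ge0 => k _; rewrite indicE ler0n. Qed.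

Lemma le_chi A B x : A `<=` B -> bounded_set B -> chi A x <= chi B x.
Proof.
move=> AB bB; rewrite -lee_fin !chi_esum//; last first.
  by move: bB => /bounded_setP[M M0 BM]; apply/bounded_setP; exists M => // y /AB /BM.
apply: le_esum => k _; rewrite lee_fin !indicE ler_nat.
by have [/set_mem/AB/mem_set ->|] := boolP (_ \in A).
Qed.

Lemma chiU A B x : bounded_set A -> bounded_set B -> A `&` B = set0 ->
  chi (A `|` B) x = chi A x + chi B x.
Proof.
move=> bA bB AB; apply: EFin_inj; rewrite EFinD !chi_esum//; last first.
  move: bA bB => /bounded_setP[M M0 AM] /bounded_setP[N N0 BN].
  apply/bounded_setP; exists (M + N); first exact: addr_gt0.
  by move=> y [/AM|/BN] yM i; apply: le_trans (yM i) _; [rewrite lerDl|rewrite lerDr]; exact: ltW.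
rewrite -esumD => [|k _|k _]; [|by rewrite lee_fin indicE ler0n..].
apply: eq_esum => k _; rewrite -EFinD !indicE in_setU; congr _%:E.
case: (boolP (_ \in A)) => yA; case: (boolP (_ \in B)) => yB /=; rewrite ?addr0 ?add0r//.
have : (A `&` B) (x + zvec k) by split; exact: set_mem.
by rewrite AB.
Qed.

Lemma chi_shift_zvec S x m : chi S (x + zvec m) = chi S x.
Proof.
rewrite [RHS](reindex_fsbigT (fun k => m + k)).
  by apply: eq_fsbigr => k _; rewrite map_mxD addrA.
by exists (fun k => - m + k) => k; rewrite ?addKr ?addNKr.
Qed.

Lemma chi_preimage_shift S v x : chi [set y | S (y + v)] x = chi S (x + v).
Proof.
by apply: eq_fsbigr => k _; rewrite !indicE /= addrAC; congr (_ : bool)%:R.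
Qed.

Lemma chi_ge1 S x m : bounded_set S -> S (x + zvec m) -> 1 <= chi S x.
Proof.
move=> bS Sx; rewrite -lee_fin chi_esum//; apply: esum_ge; exists [set m] => //.
by rewrite fsbig_set1 indicE mem_set.
Qed.

Lemma chi_eq0 S x : (forall m, ~ S (x + zvec m)) -> chi S x = 0.
Proof. by move=> nS; apply: fsbig1 => k _; rewrite indicE memNset. Qed.

(** A fundamental domain of Z^d in R^d. It is used rather than [unit_cube] because it is
    one of the boxes whose measure is known. *)
Definition torus_box : set 'rV[R]_d := box (0, const_mx 1).

Lemma exists_torus_box x : exists m, torus_box (x + zvec m).
Proof.
exists (\row_i (1 - Num.ceil (x ord0 i))) => i; rewrite !mxE /= intrB mulr1z.
have := ceil_itv (x ord0 i); rewrite intrB mulr1z; lra.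
Qed.

Lemma torus_box_inj x m m' : torus_box (x + zvec m) -> torus_box (x + zvec m') -> m = m'.
Proof.
move=> xm xm'; apply/rowP => i; have := xm i; have := xm' i; rewrite !mxE /= => h1 h2.
have l1 : (m ord0 i)%:~R < (m' ord0 i + 1)%:~R :> R by rewrite intrD mulr1z; lra.
have l2 : (m' ord0 i)%:~R < (m ord0 i + 1)%:~R :> R by rewrite intrD mulr1z; lra.
rewrite ltr_int in l1; rewrite ltr_int in l2; change (m ord0 i = m' ord0 i); lia.
Qed.

Lemma chi_torus_box x : chi torus_box x = 1.
Proof.
have [m xm] := exists_torus_box x; rewrite /chi -(fsbig_widen [set m])//.
  by rewrite fsbig_set1 indicE mem_set.
move=> k [_ /= km]; rewrite /= indicE memNset// => xk.
by apply: km; exact: torus_box_inj xk xm.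
Qed.

Lemma mes_torus_box : mes (torus_box : set (lebesgue_rV R d)) = 1%E.
Proof.
rewrite /mes lebesgue_outer_box /box_volume big1// => i _.
by rewrite !mxE subr0 max_r.
Qed.

Lemma bounded_torus_box : bounded_set torus_box.
Proof. by have [] := @Riemann_measurable_box R d (0, const_mx 1). Qed.

End chi_theory.

(** * Birkhoff sums *)

Section birkhoff.
Context {R : realType} {d : nat}.
Implicit Types (A B S : set 'rV[R]_d) (v x alpha : 'rV[R]_d) (k m : 'rV[int]_d).

Local Notation zvec k := (map_mx intr k : 'rV[R]_d).

Definition birkhoff alpha S n x : R := \sum_(k < n) chi S (x + alpha *+ k).

Lemma birkhoff_shift_zvec alpha S n x m :
  birkhoff alpha S n (x + zvec m) = birkhoff alpha S n x.
Proof. by apply: eq_bigr => k _; rewrite addrAC chi_shift_zvec. Qed.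

Lemma birkhoffU alpha A B n x : bounded_set A -> bounded_set B -> A `&` B = set0 ->
  birkhoff alpha (A `|` B) n x = birkhoff alpha A n x + birkhoff alpha B n x.
Proof.
move=> bA bB AB; rewrite /birkhoff -big_split/=.
by apply: eq_bigr => k _; rewrite chiU.
Qed.

Lemma birkhoff_preimage_shift alpha S v n x :
  birkhoff alpha [set y | S (y + v)] n x = birkhoff alpha S n (x + v).
Proof. by apply: eq_bigr => k _; rewrite chi_preimage_shift addrAC. Qed.

Lemma birkhoff_eq0 alpha S n x :
  (forall (k : nat) m, (k < n)%N -> ~ S (x + alpha *+ k + zvec m)) ->
  birkhoff alpha S n x = 0.
Proof. by move=> nX; apply: big1 => k _; apply: chi_eq0 => m; exact: nX. Qed.

Lemma exists_unit_cube x : exists m, unit_cube (x + zvec m).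
Proof.
exists (\row_i (- Num.floor (x ord0 i))) => i; rewrite !mxE /= intrN.
have := floor_itv (x ord0 i); rewrite intrD mulr1z; lra.
Qed.

(** By periodicity the exceptional sets in the unit cube can be translated over all of
    R^d, and countably many of them remain null: outside one null set the bound holds
    for all n at once. *)
Lemma bounded_remainder_set_ae alpha S : bounded_remainder_set alpha S ->
  exists2 C : R, 0 <= C &
    null [set x | exists n, C < `|birkhoff alpha S n x - n%:R * fine (mes S)|].
Proof.
move=> [bS mS [C SC]]; exists (Num.max C 0); first by rewrite le_max lexx orbT.
pose bad n : set 'rV[R]_d := [set x |
  unit_cube x /\ C < `|birkhoff alpha S n.+1 x - n.+1%:R * fine (mes S)|].
have bad0 n : null (bad n).
  have /ae_mesP := SC n.+1 isT; apply: null_sub => x [ux Cx] /(_ ux).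
  by rewrite leNgt Cx.
apply: (@null_sub _ _ _ (\bigcup_m \bigcup_n [set x | bad n (x + zvec m)])); last first.
  by apply: null_bigcup_countable => m; apply: null_bigcup => n; exact: null_shift.
move=> x [[|n]]; first by rewrite /birkhoff big_ord0 mul0r subrr normr0 gt_max ltxx andbF.
rewrite gt_max => /andP[Cx _]; have [m xm] := exists_unit_cube x.
by exists m => //; exists n => //; split => //; rewrite birkhoff_shift_zvec.
Qed.

Lemma ae_bounded_remainder_set alpha S (C : R) :
  bounded_set S -> measurable (S : set (lebesgue_rV R d)) ->
  (forall n, null [set x | C < `|birkhoff alpha S n x - n%:R * fine (mes S)|]) ->
  bounded_remainder_set alpha S.
Proof.
move=> bS mS SC; split => //; exists C => n _; apply/ae_mesP.
apply: null_sub (SC n) => x /not_implyP[_] /=.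
by move=> /negP; rewrite -ltNge.
Qed.

Let TV := lebesgue_rV R d.

Lemma measurable_torus_box : measurable (torus_box : set TV).
Proof. exact: measurable_box. Qed.

(** On a bounded domain the same finitely many translations suffice for every point. *)
Lemma chi_torus_box_finite S : bounded_set S -> exists2 F : set 'rV[int]_d, finite_set F &
  (forall x, torus_box x -> (chi S x)%:E =
     (\sum_(m \in F) (\1_[set y | S (y + zvec m)%R] x : R)%:E)%E)
  /\ (S `<=` \bigcup_(m in F) [set y | torus_box (y - zvec m)]).
Proof.
move=> /bounded_setP[M M0 SM].
exists [set m | forall i, `|zvec m ord0 i| <= M + 1]; first exact: finite_zvec.
have SF x m : torus_box x -> S (x + zvec m) -> forall i, `|zvec m ord0 i| <= M + 1.
  move=> Qx Sx i; rewrite -[zvec m](addKr x) mxE; apply: le_trans (ler_normD _ _) _.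
  rewrite addrC; apply: lerD; first exact: SM.
  have := Qx i; rewrite !mxE normrN /= ler_norml; lra.
split=> [x Qx|x Sx].
  rewrite fsumEFin; last exact: finite_zvec.
  congr _%:E; rewrite /chi -(fsbig_widen [set m | forall i, `|zvec m ord0 i| <= M + 1])//.
  move=> m [_ /= nm]; rewrite indicE memNset// => Sm; exact/nm/(SF _ _ Qx).
have [m xm] := exists_torus_box x; exists (- m); last first.
  by rewrite /= map_mxN opprK.
by apply: SF xm _; rewrite map_mxN addrK.
Qed.

Lemma measurable_chi S : bounded_set S -> measurable (S : set TV) ->
  measurable_fun (torus_box : set TV) (fun x : TV => (chi S x)%:E).
Proof.
move=> bS mS; have [F fF [SF _]] := chi_torus_box_finite bS.
apply: (eq_measurable_fun (fun x : TV =>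
    (\sum_(m \in F) (\1_[set y | S (y + zvec m)%R] x : R)%:E)%E)).
  by move=> x /set_mem/SF ->.
apply: emeasurable_fsum => // m; apply/measurable_EFinP.
by apply: measurable_indic; exact: measurable_shift.
Qed.

(** The pieces of S in the integer translates of the fundamental domain partition S. *)
Lemma integral_chi S : bounded_set S -> measurable (S : set TV) ->
  (\int[mes]_(x in (torus_box : set TV)) (chi S x)%:E = mes S)%E.
Proof.
move=> bS mS; have [F fF [SF SQ]] := chi_torus_box_finite bS.
rewrite (eq_integral (fun x : TV =>
    (\sum_(m \in F) (\1_[set y | S (y + zvec m)%R] x : R)%:E)%E)); last first.
  by move=> x /set_mem/SF ->.
rewrite (ge0_integral_fsum _ measurable_torus_box)//; first last.
  by move=> m; apply/measurable_EFinP; apply: measurable_indic; exact: measurable_shift.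
pose G m : set TV := S `&` [set y | torus_box (y - zvec m)].
have mG m : measurable (G m).
  by apply: measurableI => //; apply: measurable_shift; exact: measurable_torus_box.
rewrite (eq_fsbigr (fun m => mes (G m))); last first.
  move=> m _; rewrite integral_indic; [|exact: measurable_torus_box|exact: measurable_shift].
  rewrite [RHS]/mes -(lebesgue_outer_shift (zvec m)); congr lebesgue_outer.
  by apply/seteqP; split => x [/= x1 x2]; split => //=; move: x2; rewrite addrK.
rewrite -measure_fin_bigcup//; last first.
  move=> m m' _ _ [x [[_ /= xm] [_ /= xm']]].
  by apply: oppr_inj; apply: (@torus_box_inj _ _ x); rewrite map_mxN.
congr mes; apply/seteqP; split => [x [m _ []]//|x Sx].
by have [m Fm xm] := SQ x Sx; exists m.
Qed.

Lemma bounded_mes_fin S : bounded_set S -> mes (S : set TV) \is a fin_num.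
Proof.
move=> /bounded_setP[M M0 SM]; rewrite ge0_fin_numE; last exact: lebesgue_outer_ge0.
apply: (@le_lt_trans _ _ (lebesgue_outer (box (const_mx (- M - 1), const_mx M : 'rV[R]_d)))).
  apply: le_lebesgue_outer => x /SM xM i; rewrite !mxE/=.
  by have := xM i; rewrite ler_norml; lra.
by rewrite lebesgue_outer_box ltry.
Qed.

Lemma measurable_chi_shift S v : bounded_set S -> measurable (S : set TV) ->
  measurable_fun (torus_box : set TV) (fun x : TV => (chi S ((x : 'rV[R]_d) + v))%:E).
Proof.
move=> bS mS; have := measurable_chi (bounded_set_shift v bS) (measurable_shift v mS).
by under eq_fun do rewrite chi_preimage_shift.
Qed.

Lemma measurable_birkhoff alpha S n : bounded_set S -> measurable (S : set TV) ->
  measurable_fun (torus_box : set TV) (fun x : TV => (birkhoff alpha S n x)%:E).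
Proof.
move=> bS mS; under eq_fun do rewrite /birkhoff -sumEFin.
by apply: emeasurable_sum => k; exact: measurable_chi_shift.
Qed.

Lemma integral_birkhoff alpha S n : bounded_set S -> measurable (S : set TV) ->
  (\int[mes]_(x in (torus_box : set TV)) (birkhoff alpha S n x)%:E =
   (n%:R * fine (mes (S : set TV)))%:E)%E.
Proof.
move=> bS mS; under eq_integral do rewrite /birkhoff -sumEFin.
rewrite (ge0_integral_sum _ measurable_torus_box)//=; first last.
- by move=> k x _; rewrite lee_fin chi_ge0.
- by move=> k; exact: measurable_chi_shift.
rewrite (eq_bigr (fun=> (fine (mes (S : set TV)))%:E)).
  by rewrite sumEFin sumr_const card_ord mulr_natl.
move=> k _; rewrite (fineK (bounded_mes_fin bS)).
transitivity (mes ([set y | S (y + alpha *+ k)%R] : set TV)); last exact: lebesgue_outer_shift.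
rewrite -(integral_chi (bounded_set_shift (alpha *+ k) bS) (measurable_shift (alpha *+ k) mS)).
by apply: eq_integral => x _; rewrite chi_preimage_shift.
Qed.

(** The mean of the Birkhoff sum over the fundamental domain is n mes S, so n mes S and
    n D stay within C of each other for all n. *)
Lemma density_eq_mes alpha S (C D : R) : 0 <= D -> 0 <= C ->
  bounded_set S -> measurable (S : set TV) ->
  (forall n, null [set x | C < `|birkhoff alpha S n x - n%:R * D|]) ->
  D = fine (mes (S : set TV)).
Proof.
move=> D0 C0 bS mS SC; set s := fine _.
have b0 n x : (0 <= (birkhoff alpha S n x)%:E)%E.
  by rewrite lee_fin; apply: sumr_ge0 => k _; exact: chi_ge0.
have key n : `|n%:R * (D - s)| <= C.
  have ae1 : {ae mes, forall x : TV, torus_box x -> `|birkhoff alpha S n x - n%:R * D| <= C}.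
    apply/ae_mesP; apply: null_sub (SC n) => x /not_implyP[_] /= /negP.
    by rewrite -ltNge.
  have mb := measurable_birkhoff alpha n bS mS.
  have cst (r : R) : (\int[mes]_(x in (torus_box : set TV)) r%:E = r%:E)%E.
    rewrite (integral_cst _ measurable_torus_box) -[RHS]mule1; congr (_ * _)%E.
    exact: mes_torus_box.
  have up : (n%:R * s <= n%:R * D + C).
    rewrite -lee_fin -(integral_birkhoff alpha n bS mS) -[leRHS]cst.
    apply: ae_ge0_le_integral => //; first exact: measurable_torus_box.
    - by move=> x _; rewrite lee_fin addr_ge0// mulr_ge0.
    - by apply: filterS ae1 => x + Qx => /(_ Qx); rewrite lee_fin ler_norml; lra.
  have lo : (n%:R * D <= n%:R * s + C).
    rewrite -lee_fin EFinD -(integral_birkhoff alpha n bS mS) -(cst (n%:R * D)) -(cst C).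
    rewrite -ge0_integralD//; last exact: measurable_torus_box.
    apply: ae_ge0_le_integral => //; first exact: measurable_torus_box.
    - by move=> x _; rewrite lee_fin mulr_ge0.
    - by move=> x _; rewrite adde_ge0.
    - by apply: emeasurable_funD.
    - by apply: filterS ae1 => x + Qx => /(_ Qx); rewrite -EFinD lee_fin ler_norml; lra.
  by rewrite mulrBr ler_norml; lra.
apply/eqP; rewrite -subr_eq0; apply/negPn/negP; rewrite -normr_gt0 => Ds.
have := key (Num.truncn (C / `|D - s|)).+1.
by rewrite normrM ger0_norm// -ler_pdivlMr// leNgt truncnS_gt.
Qed.

End birkhoff.

(** * Birkhoff sums as counts of lattice points *)

Section lattice.
Context {R : realType} {d : nat}.
Implicit Types (S : set 'rV[R]_d) (x alpha : 'rV[R]_d) (l : 'rV[int]_(1 + d)).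

Local Notation zvec k := (map_mx intr k).

(** The rows alpha, e_1, ..., e_d generate the group Z alpha + Z^d. *)
Definition gen_mx alpha : 'M[R]_(1 + d, d) := col_mx alpha 1%:M.

Definition lattice_point alpha l : 'rV[R]_d := zvec l *m gen_mx alpha.

Lemma row_mx_ord0 (T : Type) (u : 'M[T]_1) (v : 'rV[T]_d) :
  row_mx u v ord0 ord0 = u ord0 ord0.
Proof.
have -> : (ord0 : 'I_(1 + d)) = lshift d ord0 by apply/val_inj.
exact: row_mxEl.
Qed.

Lemma lattice_pointE alpha l :
  lattice_point alpha l = (l ord0 ord0)%:~R *: alpha + zvec (rsubmx l).
Proof.
rewrite /lattice_point /gen_mx -[in LHS](hsubmxK l) map_row_mx mul_row_col mulmx1.
congr (_ + _); apply/rowP => j; rewrite !mxE big_ord1 !mxE.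
by congr (_%:~R * _); congr (l _ _); apply/val_inj.
Qed.

Lemma lattice_pointD alpha l l' :
  lattice_point alpha (l + l') = lattice_point alpha l + lattice_point alpha l'.
Proof. by rewrite /lattice_point map_mxD mulmxDl. Qed.

Lemma integer_spanP alpha v : integer_span alpha v <-> exists l, v = lattice_point alpha l.
Proof.
split=> [[n [m ->]]|[l ->]]; last by rewrite lattice_pointE; do 2!eexists.
exists (row_mx n%:M m); rewrite lattice_pointE row_mxKr; congr (_%:~R *: _ + _).
by rewrite row_mx_ord0 mxE.
Qed.

(** One coordinate of the equation k alpha + m = 0 is a rational relation between 1 and
    alpha_j; it forces k = 0, and then m = 0. *)
Lemma lattice_point_inj alpha l : (1 <= d)%N -> irrational_vector alpha ->
  lattice_point alpha l = 0 -> l = 0.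
Proof.
move=> d0 irr; rewrite lattice_pointE => l0.
have eq_j j : (l ord0 ord0)%:~R * alpha ord0 j + (rsubmx l ord0 j)%:~R = 0.
  by have := congr1 (fun v : 'rV[R]_d => v ord0 j) l0; rewrite !mxE.
pose j0 : 'I_d := Ordinal d0.
pose c : 'rV[rat]_(1 + d) := row_mx (const_mx (rsubmx l ord0 j0)%:~R)
   (\row_j if j == j0 then (l ord0 ord0)%:~R else 0).
have : c = 0.
  apply: irr; rewrite big_split_ord/= big_ord1 !row_mxEl !mxE mulr1 (bigD1 j0)//=.
  rewrite big1 => [|j jj0]; last by rewrite !row_mxEr !mxE (negbTE jj0) raddf0 mul0r.
  by rewrite !row_mxEr !mxE eqxx !ratr_int addr0 addrC; have := eq_j j0; rewrite !mxE.
move=> c0; have k0 : l ord0 ord0 = 0.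
  have := congr1 (fun v : 'rV[rat]_(1 + d) => v ord0 (rshift 1 j0)) c0.
  by rewrite row_mxEr !mxE eqxx => /eqP; rewrite intr_eq0 => /eqP.
rewrite -(hsubmxK l); apply/rowP => j; case: (split_ordP j) => i ->.
  rewrite row_mxEl !mxE -[RHS]k0; congr (l _ _); apply/val_inj => /=.
  by rewrite (ord1 i).
have := eq_j i; rewrite k0 mul0r add0r row_mxEr => /eqP.
by rewrite intr_eq0 => /eqP ->; rewrite mxE.
Qed.

(** The values are in [\bar R] so that the sum can be reindexed freely. *)
Definition lattice_count alpha S x (P : set 'rV[int]_(1 + d)) : \bar R :=
  (\esum_(l in P) (\1_S (x + lattice_point alpha l)%R : R)%:E)%E.

(** The two conditions need only be compared at the points that are counted. *)
Lemma le_lattice_count alpha S x (P Q : set 'rV[int]_(1 + d)) :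
  (forall l, S (x + lattice_point alpha l) -> P l -> Q l) ->
  (lattice_count alpha S x P <= lattice_count alpha S x Q)%E.
Proof.
move=> PQ; rewrite /lattice_count esum_mkcond [leRHS]esum_mkcond.
apply: le_esum => l _; have [Sl|nSl] := pselect (S (x + lattice_point alpha l)).
  case: ifPn => [/set_mem/(PQ l Sl)/mem_set ->//|_].
  by case: ifP => // _; rewrite lee_fin indicE ler0n.
by rewrite indicE (memNset nSl); case: ifP => _; case: ifP.
Qed.

Lemma lattice_count_strip alpha S x (a : int) (n : nat) : bounded_set S ->
  lattice_count alpha S x [set l | a <= l ord0 ord0 < a + n%:Z] =
  (birkhoff alpha S n (x + a%:~R *: alpha))%:E.
Proof.
move=> bS; rewrite /birkhoff -sumEFin.
transitivity (\sum_(j < n) \esum_(m in [set: 'rV[int]_d])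
   (\1_S (x + a%:~R *: alpha + alpha *+ j + zvec m)%R : R)%:E)%E; last first.
  by apply: eq_bigr => j _; rewrite chi_esum.
rewrite (fsbig_ord _ _ (fun j => \esum_(m in [set: 'rV[int]_d])
   (\1_S (x + a%:~R *: alpha + alpha *+ j + zvec m)%R : R)%:E)%E).
rewrite -esum_fset//; last by move=> j _; apply: esum_ge0 => m _; rewrite lee_fin indicE ler0n.
rewrite esum_esum; last by move=> j m _ _; rewrite lee_fin indicE ler0n.
pose h (p : nat * 'rV[int]_d) : 'rV[int]_(1 + d) := row_mx (a + p.1%:Z)%:M p.2.
have h0 p : h p ord0 ord0 = a + p.1%:Z.
  by rewrite /h row_mx_ord0 mxE.
rewrite /lattice_count (reindex_esum (`I_n `*`` fun=> setT) _ h); last first.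
  split.
  - by move=> [j m] [/= jn _]; rewrite h0 /=; lia.
  - move=> [j m] [j' m'] _ _ hh; have := h0 (j, m); rewrite hh h0/= => E.
    by move: hh; rewrite /h/= => /eq_row_mx[_ ->]; congr (_, _); lia.
  - move=> l /= la; exists (absz (l ord0 ord0 - a), rsubmx l) => /=.
      by split => //=; lia.
    rewrite /h /= -[RHS]hsubmxK; congr row_mx; apply/rowP => i.
    rewrite !mxE (ord1 i) eqxx gez0_abs; last by lia.
    by rewrite mulr1n addrCA subrr addr0; congr (l _ _); exact/val_inj.
apply: eq_esum => -[j m] _ /=; rewrite lattice_pointE h0 /h row_mxKr intrD scalerDl.
by rewrite !addrA -pmulrn scaler_nat.
Qed.

End lattice.

Section strips.
Context {R : realType} {d : nat}.
Implicit Types (S : set 'rV[R]_d) (x alpha : 'rV[R]_d) (l : 'rV[int]_(1 + d)).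

Lemma int_interval (p q : R) : p <= q -> exists (a : int) (n : nat),
  (forall k : int, (p <= k%:~R < q) = (a <= k < a + n%:Z)) /\ `|n%:R - (q - p)| <= 1.
Proof.
move=> pq; have ab : Num.ceil p <= Num.ceil q by apply: ceil_le.
exists (Num.ceil p), (absz (Num.ceil q - Num.ceil p)); split=> [k|].
  rewrite gez0_abs ?subr_ge0// [_ + (_ - _)]addrC subrK.
  by rewrite ceil_le_int ceil_gt_int.
have -> : (absz (Num.ceil q - Num.ceil p))%:R = (Num.ceil q)%:~R - (Num.ceil p)%:~R :> R.
  by rewrite natr_absz -intrB; congr _%:~R; rewrite ger0_norm// subr_ge0.
rewrite ler_norml.
have := ceil_itv p; have := ceil_itv q; rewrite !intrB !mulr1z; lra.
Qed.

Lemma int_interval_oc (p q : R) : p <= q -> exists (a : int) (n : nat),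
  (forall k : int, (p < k%:~R <= q) = (a <= k < a + n%:Z)) /\ `|n%:R - (q - p)| <= 1.
Proof.
move=> pq; have [|a [n [an nd]]] := @int_interval (- q) (- p); first by rewrite lerN2.
exists (- (a + n%:Z) + 1), n; split => [k|]; last by move: nd; rewrite opprK [- p + q]addrC.
transitivity (- q <= (- k)%:~R < - p).
  by rewrite intrN lerN2 ltrN2 andbC.
rewrite an; apply/idP/idP; lia.
Qed.

Lemma int_strip (c u w : R) : c != 0 -> u <= w -> exists (a : int) (n : nat),
  (forall k : int, (u <= c * k%:~R < w) = (a <= k < a + n%:Z)) /\
  `|n%:R - (w - u) / `|c| | <= 1.
Proof.
move=> c0 uw; case: (ltrgt0P c) c0 => // cp _.
  have [|a [n [an nd]]] := @int_interval (u / c) (w / c).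
    by rewrite ler_pM2r// invr_gt0.
  exists a, n; split => [k|]; last by rewrite mulrBl.
  by rewrite -an ler_pdivrMr// ltr_pdivlMr// ![_ * c]mulrC.
have [|a [n [an nd]]] := @int_interval_oc (w / c) (u / c).
  by rewrite ler_nM2r// invr_lt0.
exists a, n; split => [k|]; last by rewrite invrN mulrN -mulNr opprB mulrBl.
by rewrite -an ltr_ndivrMr// ler_ndivlMr// ![_ * c]mulrC andbC.
Qed.

Definition strip (c u w : R) : set 'rV[int]_(1 + d) :=
  [set l | u <= c * (l ord0 ord0)%:~R < w].

(** The times k with u <= c k < w form an integer interval of length (w - u) / |c| up to
    an error of at most 1. The lower bound also holds when w < u, as it is then negative
    or zero; this covers short Birkhoff sums. *)
Lemma lattice_count_strip_bounds alpha S x (C s c u w : R) : bounded_set S ->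
  0 <= s -> 0 <= C -> c != 0 ->
  (forall (a : int) n, `|birkhoff alpha S n (x + a%:~R *: alpha) - n%:R * s| <= C) ->
  ((((w - u) / `|c| * s - (C + s))%:E <=
    lattice_count alpha S x (strip c u w)) /\
  ((u <= w)%R -> lattice_count alpha S x (strip c u w) <=
    ((w - u) / `|c| * s + (C + s))%:E))%E.
Proof.
move=> bS s0 C0 c0 good; have c1 : 0 < `|c| by rewrite normr_gt0.
have [uw|wu] := leP u w; last first.
  split; last by [].
  apply: (@le_trans _ _ 0%E); last first.
    by apply: esum_ge0 => l _; rewrite lee_fin indicE ler0n.
  rewrite lee_fin subr_le0; apply: (@le_trans _ _ 0); last exact: addr_ge0.
  by rewrite mulr_le0_ge0// mulr_le0_ge0 ?invr_ge0// subr_le0 ltW.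
have [a [n [an nd]]] := int_strip c0 uw.
have -> : strip c u w =
    [set l : 'rV[int]_(1 + d) | a <= l ord0 ord0 < a + n%:Z].
  by apply/seteqP; split => l; rewrite /strip /= an.
rewrite lattice_count_strip// !lee_fin; have := good a n.
set t := (w - u) / _ in nd *.
have : `|n%:R * s - t * s| <= s.
  by rewrite -mulrBl normrM (ger0_norm s0) ler_piMl.
by rewrite !ler_norml => *; split => [|_]; lra.
Qed.

End strips.

(** * Cosets of the image of an integer matrix *)

Section cosets.
Variables (n : nat) (A : 'M[int]_n).
Hypothesis A_inj : forall l : 'rV[int]_n, l *m A = 0 -> l = 0.

Definition coset (l : 'rV[int]_n) : set 'rV[int]_n := [set l' | exists mu, l' = l + mu *m A].

(** The choice depends on the coset only, and not on l, since equal cosets are equal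
    sets. *)
Definition coset_rep l := xget 0 (coset l).

Lemma coset_repP l : coset l (coset_rep l).
Proof. by apply: (@xgetPex _ 0 (coset l)); exists l; exists 0; rewrite mul0mx addr0. Qed.

Lemma coset_rep_eq l mu : coset_rep (l + mu *m A) = coset_rep l.
Proof.
rewrite /coset_rep; congr xget; apply/seteqP; split => l' [nu ->].
  by exists (mu + nu); rewrite mulmxDl addrA.
  by exists (nu - mu); rewrite mulmxBl -addrA [mu *m A + _]addrC subrK.
Qed.

Lemma coset_rep_idem l : coset_rep (coset_rep l) = coset_rep l.
Proof. by have [mu E] := coset_repP l; rewrite {1}E coset_rep_eq. Qed.

Lemma det_neq0 : \det A != 0.
Proof. by apply/negP => /det0P[v v0 vA]; move/negP: v0; apply; apply/eqP/A_inj. Qed.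

(** As \adj A *m A = \det A, reducing the entries modulo \det A does not change the
    coset. *)
Lemma finite_coset_rep : finite_set (range coset_rep).
Proof.
pose N := absz (\det A).
have N0 : (0 < N)%N by rewrite absz_gt0 det_neq0.
pose h (f : 'rV['I_N]_n) : 'rV[int]_n := \row_i (f ord0 i : nat)%:Z.
apply: (@sub_finite_set _ _ ((coset_rep \o h) @` setT)).
  move=> _ [l _ <-].
  pose r : 'rV[int]_n := \row_i (l ord0 i %% \det A)%Z.
  pose q : 'rV[int]_n := \row_i (l ord0 i %/ \det A)%Z.
  have rN i : (absz (r ord0 i) < N)%N.
    rewrite mxE -ltz_nat gez0_abs ?modz_ge0 ?det_neq0//.
    by rewrite abszE ltz_mod ?det_neq0.
  exists (\row_i Ordinal (rN i)) => //=.
  have -> : h (\row_i Ordinal (rN i)) = r.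
    by apply/rowP => i; rewrite !mxE /= gez0_abs// mxE modz_ge0 ?det_neq0.
  rewrite -[LHS](coset_rep_eq _ (q *m \adj A)); congr coset_rep.
  rewrite -mulmxA mul_adj_mx mul_mx_scalar; apply/rowP => i.
  by rewrite !mxE mulrC addrC -divz_eq.
by apply: finite_image; exact: finite_finset.
Qed.

End cosets.

(** * A linear map between the groups preserves bounded remainder sets *)

Section transfer.
Context {R : realType} {d : nat}.
Variables (alpha beta : 'rV[R]_d) (T U : {linear 'rV[R]_d -> 'rV[R]_d}).
Hypotheses (TU : cancel T U) (UT : cancel U T).
Implicit Types (S : set 'rV[R]_d) (x y v w : 'rV[R]_d) (l mu t : 'rV[int]_(1 + d)).

Local Notation zvec k := (map_mx intr k).

Lemma integer_span_matrix : T @` integer_span alpha `<=` integer_span beta ->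
  exists A : 'M[int]_(1 + d), forall l, T (lattice_point alpha l) = lattice_point beta (l *m A).
Proof.
move=> Tab.
have /choice[lam lamP] i : exists l, T (lattice_point alpha (delta_mx 0 i)) = lattice_point beta l.
  apply/integer_spanP/Tab; exists (lattice_point alpha (delta_mx 0 i)) => //.
  by apply/integer_spanP; eexists.
exists (\matrix_i lam i) => l.
rewrite /lattice_point -mul_rV_lin1 map_mxM -!mulmxA; congr (_ *m _).
apply/row_matrixP => i; rewrite 2!row_mul -map_row rowK -/(lattice_point _ _) -lamP.
by rewrite -mul_rV_lin1 /lattice_point map_delta_mx rowE.
Qed.

Variable A : 'M[int]_(1 + d).
Hypothesis TA : forall l, T (lattice_point alpha l) = lattice_point beta (l *m A).
Hypothesis A_inj : forall l, l *m A = 0 -> l = 0.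

(** The line of [kappa alpha] is the kernel of [gen_mx alpha]; [c] is the factor by which A
    stretches it, and [phi] is the time coordinate of A restricted to R^d. *)
Let AR : 'M[R]_(1 + d) := zvec A.
Let kappa (gamma : 'rV[R]_d) : 'rV[R]_(1 + d) := row_mx 1%:M (- gamma).
Let c : R := (kappa alpha *m AR) ord0 ord0.
Let phi v : R := (row_mx 0 v *m AR : 'rV_(1 + d)) ord0 ord0.

Lemma AR_gen : gen_mx alpha *m lin1_mx T = AR *m gen_mx beta.
Proof.
apply/row_matrixP => i; rewrite !rowE mulmxA.
have := TA (delta_mx 0 i); rewrite /lattice_point -mul_rV_lin1 map_mxM map_delta_mx.
by rewrite !mulmxA.
Qed.

(** A sends the kernel of [gen_mx alpha] into that of [gen_mx beta], so its value at
    [kappa alpha] is c times [kappa beta]; it cannot vanish as A is invertible. *)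
Lemma slope_neq0 : c != 0.
Proof.
apply/eqP => c0.
have AU : AR \in unitmx.
  by rewrite unitmxE unitfE /AR det_map_mx intr_eq0 det_neq0.
have k0 : kappa alpha *m AR = 0.
  have := congr1 (mulmx (kappa alpha)) AR_gen.
  rewrite mulmxA /kappa /gen_mx mul_row_col mul1mx mulmx1 subrr mul0mx mulmxA -/(kappa _).
  rewrite -[kappa alpha *m AR]hsubmxK mul_row_col mulmx1.
  have -> : lsubmx (kappa alpha *m AR) = 0.
    apply/rowP => i; rewrite (ord1 i) mxE [RHS]mxE -c0 /c.
    by congr ((kappa alpha *m AR) _ _); apply/val_inj.
  by rewrite mul0mx add0r => <-; rewrite row_mx0.
have : kappa alpha = 0 by rewrite -[kappa alpha](mulmxK AU) k0 mul0mx.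
move=> /(congr1 (fun v : 'rV[R]_(1 + d) => v ord0 ord0)) /eqP.
by rewrite /kappa row_mx_ord0 !mxE oner_eq0.
Qed.

Lemma phiD v w : phi (v + w) = phi v + phi w.
Proof. by rewrite /phi -[in row_mx _ _](addr0 0) -add_row_mx mulmxDl mxE. Qed.

(** Decompose l as its time coordinate times [kappa alpha] plus a vector of R^d. *)
Lemma first_coord l : ((l *m A) ord0 ord0)%:~R =
  c * (l ord0 ord0)%:~R + phi (lattice_point alpha l) :> R.
Proof.
have -> : ((l *m A) ord0 ord0)%:~R = (zvec l *m AR) ord0 ord0 :> R.
  by rewrite /AR -map_mxM [RHS]mxE.
have -> : zvec l =
    (l ord0 ord0)%:~R *: kappa alpha + row_mx 0 (lattice_point alpha l) :> 'rV[R]_(1 + d).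
  rewrite -[zvec l]hsubmxK /kappa scale_row_mx add_row_mx addr0 lattice_pointE scalerN addKr.
  rewrite -map_rsubmx; congr row_mx; apply/rowP => i.
  by rewrite (ord1 i) !mxE eqxx mulr1; congr (l _ _)%:~R; apply/val_inj.
by rewrite mulmxDl -scalemxAl mxE [X in X + _]mxE mulrC.
Qed.

Lemma phi_bounded S : bounded_set S -> exists2 E, 0 <= E & forall v, S v -> `|phi v| <= E.
Proof.
move=> /bounded_setP[M M0 SM].
exists (\sum_(j < d) M * `|AR (rshift 1 j) ord0|).
  by apply: sumr_ge0 => j _; rewrite mulr_ge0// ltW.
move=> v /SM vM; rewrite /phi mxE big_split_ord/= big_ord1 row_mxEl mxE mul0r add0r.
apply: le_trans (ler_norm_sum _ _ _) _; apply: ler_sum => j _.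
by rewrite row_mxEr normrM ler_wpM2r.
Qed.

Let K : set 'rV[int]_(1 + d) := range (coset_rep A).

(** Each lattice point is t + mu A for exactly one representative t and one mu, and
    the beta-projection of mu A is the image by T of the alpha-projection of mu. *)
Lemma lattice_count_cosets S y (n : nat) :
  lattice_count beta (T @` S) y [set l : 'rV[int]_(1 + d) | 0 <= l ord0 ord0 < 0 + n%:Z] =
  (\esum_(t in K) lattice_count alpha S (U (y + lattice_point beta t)%R)
     [set mu : 'rV[int]_(1 + d) | 0 <= (t + mu *m A) ord0 ord0 < n%:Z]%R)%E.
Proof.
rewrite /lattice_count esum_esum; last by move=> t mu _ _; rewrite lee_fin indicE ler0n.
pose I t := [set mu : 'rV[int]_(1 + d) | 0 <= (t + mu *m A) ord0 ord0 < n%:Z].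
rewrite (reindex_esum (K `*`` I) _ (fun p => p.1 + p.2 *m A)); last first.
  split.
  - by move=> [t mu] [_ /= mun]; rewrite add0r.
  - move=> [t mu] [t' mu']; rewrite !inE => -[[l _ /= lt] _] [[l' _ /= lt'] _] /= E.
    have tt : t = t'.
      have := congr1 (coset_rep A) E; rewrite !coset_rep_eq.
      by rewrite -lt -lt' !coset_rep_idem.
    rewrite tt in E *; move/addrI: E => E; congr (_, _).
    apply/eqP; rewrite -subr_eq0; apply/eqP/A_inj.
    by rewrite mulmxBl E subrr.
  - move=> l /=; rewrite add0r => ln; have [nu E] := coset_repP A l.
    have El : coset_rep A l + - nu *m A = l by rewrite E mulNmx addrK.
    by exists (coset_rep A l, - nu) => //; split; [exists l|rewrite /I /= El].
apply: eq_esum => -[t mu] _ /=; rewrite !indicE; congr (_ : bool)%:R%:E.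
rewrite lattice_pointD -TA addrA; apply/idP/idP => /set_mem; last first.
  by move=> Sx; apply/mem_set; eexists; [exact: Sx|rewrite linearD UT].
by move=> [x Sx xE]; apply/mem_set; rewrite -[U _ + _]TU linearD UT -xE TU.
Qed.

(** In the coset of t, the points counted have time c k(mu) + r_t up to an error E, where
    r_t depends on y but E does not. Hence the count lies between those for two strips
    of widths n - 2 E and n + 2 E. *)
Lemma birkhoff_transfer S (C : R) : bounded_set S -> bounded_set (T @` S) -> 0 <= C ->
  exists2 D : R, 0 <= D & exists2 C' : R, 0 <= C' & forall y,
  (forall t (a : int) n, `|birkhoff alpha S n (U (y + lattice_point beta t) + a%:~R *: alpha)
       - n%:R * fine (mes S)| <= C) ->
  forall n, `|birkhoff beta (T @` S) n y - n%:R * D| <= C'.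
Proof.
move=> bS bTS C0; set s := fine _.
have s0 : 0 <= s by rewrite fine_ge0// lebesgue_outer_ge0.
have [E E0 SE] := phi_bounded bS.
have fK : finite_set K by exact: finite_coset_rep.
(* the number of cosets *)
pose N : R := \sum_(t <- finmap.enum_fset (fset_set K)) 1.
have N0 : 0 <= N by apply: sumr_ge0.
have c0 := slope_neq0; have c1 : 0 < `|c| by rewrite normr_gt0.
have c1i : 0 <= `|c|^-1 by rewrite invr_ge0 ltW.
exists (N * (s / `|c|)); first by rewrite !mulr_ge0.
exists (N * (2 * E / `|c| * s + (C + s))).
  by rewrite mulr_ge0// addr_ge0 ?addr_ge0 ?mulr_ge0.
move=> y good n.
pose r t : R := (t ord0 ord0)%:~R - phi (U (y + lattice_point beta t)).
pose W t := [set mu : 'rV[int]_(1 + d) | 0 <= (t + mu *m A) ord0 ord0 < n%:Z].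
have WE t mu : S (U (y + lattice_point beta t) + lattice_point alpha mu) ->
    `|((t + mu *m A) ord0 ord0)%:~R - (c * (mu ord0 ord0)%:~R + r t)| <= E.
  move=> /SE; rewrite phiD mxE intrD first_coord /r.
  by rewrite !ler_norml; lra.
have W0 t mu : W t mu <-> (0 <= (((t + mu *m A) ord0 ord0)%:~R : R) < n%:R).
  by rewrite /W /= ler0z -[n%:R]/(n%:Z%:~R) ltr_int.
have bounds t : ((((n%:R - 2 * E) / `|c| * s - (C + s))%:E <=
    lattice_count alpha S (U (y + lattice_point beta t)%R) (W t)) /\
    (lattice_count alpha S (U (y + lattice_point beta t)%R) (W t) <=
    ((n%:R + 2 * E) / `|c| * s + (C + s))%:E))%E.
  have strips (u w : R) := lattice_count_strip_bounds u w bS s0 C0 c0 (good t).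
  split.
    have [lo _] := strips (- r t + E) (n%:R - r t - E).
    apply: (@le_trans _ _ (lattice_count alpha S (U (y + lattice_point beta t)%R)
      (strip c (- r t + E) (n%:R - r t - E)))).
      by rewrite (_ : n%:R - 2 * E = n%:R - r t - E - (- r t + E))//; lra.
    apply: le_lattice_count => mu /WE; rewrite W0 /strip /= ler_norml => *.
    by apply/andP; split; lra.
  have [_] := strips (- r t - E) (n%:R - r t + E).
  rewrite (_ : n%:R - r t + E - (- r t - E) = n%:R + 2 * E); last by lra.
  have nr0 : 0 <= n%:R :> R by [].
  have uw : - r t - E <= n%:R - r t + E by lra.
  move=> /(_ uw); apply: le_trans.
  apply: le_lattice_count => mu /WE; rewrite W0 /strip /= ler_norml => *.
  by apply/andP; split; lra.
have := lattice_count_cosets S y n.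
rewrite lattice_count_strip// scale0r addr0 esum_fset//; last first.
  by move=> t _; apply: esum_ge0 => mu _; rewrite lee_fin indicE ler0n.
rewrite fsbig_finite// => birE.
have up : birkhoff beta (T @` S) n y <= N * ((n%:R + 2 * E) / `|c| * s + (C + s)).
  rewrite -lee_fin birE mulr_suml -sumEFin; apply: lee_sum => t _.
  by rewrite mul1r; have [] := bounds t.
have lo : N * ((n%:R - 2 * E) / `|c| * s - (C + s)) <= birkhoff beta (T @` S) n y.
  rewrite -lee_fin birE mulr_suml -sumEFin; apply: lee_sum => t _.
  by rewrite mul1r; have [] := bounds t.
rewrite ler_distl; apply/andP; split.
  by rewrite (_ : _ - _ = N * ((n%:R - 2 * E) / `|c| * s - (C + s)))//; ring.
by rewrite (_ : _ + _ = N * ((n%:R + 2 * E) / `|c| * s + (C + s)))//; ring.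
Qed.

(** The points y for which some starting point in [birkhoff_transfer] is exceptional form
    a countable union of translated linear images of a null set. *)
Lemma bounded_remainder_set_linear S :
  Riemann_measurable S -> bounded_remainder_set alpha S -> bounded_remainder_set beta (T @` S).
Proof.
move=> RS brs; have [bS _ _] := brs.
have TSE : T @` S = U @^-1` S.
  by apply/seteqP; split => [_ [x Sx <-]|x Sx] /=; [rewrite TU|exists (U x)].
have RTS : Riemann_measurable (T @` S) by rewrite TSE; exact: (@Riemann_measurable_linear _ _ U T).
have bTS := RTS.1; have mTS := Riemann_measurable_measurable RTS.
have [C C0 badC] := bounded_remainder_set_ae brs.
set bad := [set x | _] in badC.
have [D D0 [C' C'0 DC']] := birkhoff_transfer bS bTS C0.
have nul n : null [set x | C' < `|birkhoff beta (T @` S) n x - n%:R * D|].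
  apply: (@null_sub _ _ _ (\bigcup_t \bigcup_(a : int)
    [set y | (T @` [set v | bad (v + a%:~R *: alpha)]) (y + lattice_point beta t)])); last first.
    apply: null_bigcup_countable => t; apply: null_bigcup_countable => a.
    by apply: null_shift; apply: null_image; apply: null_shift.
  move=> y /= Cy; apply: contrapT => nbad.
  move: Cy; rewrite ltNge => /negP; apply; apply: DC' => t a m.
  rewrite leNgt; apply/negP => Cbad; apply: nbad; exists t => //; exists a => //=.
  by exists (U (y + lattice_point beta t)); [exists m|rewrite UT].
have DE := density_eq_mes D0 C'0 bTS mTS nul.
by apply: (@ae_bounded_remainder_set _ _ _ _ C') => // n; rewrite -DE.
Qed.

End transfer.

(** * Exchanging pieces of a fundamental domain *)

Section exchange.
Context {R : realType} {d : nat}.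
Implicit Types (S V W X : set 'rV[R]_d) (x y v w g : 'rV[R]_d) (m : 'rV[int]_d).

Local Notation zvec k := (map_mx intr k : 'rV[R]_d).

(** Both sums contain the terms of index q, ..., n - 1 when q <= n; in general they
    differ by two blocks of q terms. *)
Lemma sum_shift_bound (h : nat -> R) (q n : nat) : (forall k, 0 <= h k <= 1) ->
  `|\sum_(k < n) h k - \sum_(k < n) h (q + k)%N| <= q%:R.
Proof.
move=> h01; have E : \sum_(k < n) h k + \sum_(k < q) h (n + k)%N =
    \sum_(k < q) h k + \sum_(k < n) h (q + k)%N.
  by transitivity (\sum_(k < n + q) h k); [|rewrite addnC]; rewrite big_split_ord.
have bound (f : nat -> R) : (forall k, 0 <= f k <= 1) -> 0 <= \sum_(k < q) f k <= q%:R.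
  move=> f01; apply/andP; split; first by apply: sumr_ge0 => k _; case/andP: (f01 k).
  rewrite -[q in leRHS]card_ord -sumr_const; apply: ler_sum => k _.
  by case/andP: (f01 k).
have /andP[a1 a2] := bound h h01.
have /andP[b1 b2] := bound (fun k => h (n + k)%N) (fun k => h01 _).
by rewrite ler_norml; apply/andP; split; lra.
Qed.

(** The integer translation by M moves the rest of the fundamental domain out of the way
    of V + g without changing its periodization. *)
Definition exchanged V (M : 'rV[int]_d) g : set 'rV[R]_d :=
  [set x | (torus_box `\` V) (x - zvec M)] `|` [set x | V (x - g)].

Lemma Riemann_measurable_exchanged V M g : Riemann_measurable V ->
  Riemann_measurable (exchanged V M g).
Proof.
move=> RV; apply: Riemann_measurableU; apply: Riemann_measurable_shift => //.
by apply: Riemann_measurableD => //; exact: Riemann_measurable_box.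
Qed.

(** Modulo Z^d the set differs from a fundamental domain by moving V to V + q alpha, so
    its Birkhoff sums are n plus a telescoping sum. The density theorem then gives the
    measure 1. *)
Lemma bounded_remainder_set_exchanged alpha V (M : 'rV[int]_d) (q : nat) m :
  Riemann_measurable V -> V `<=` torus_box ->
  let g := alpha *+ q + zvec m in
  [set x | (torus_box `\` V) (x - zvec M)] `&` [set x | V (x - g)] = set0 ->
  bounded_remainder_set alpha (exchanged V M g).
Proof.
move=> RV VQ g disj; have RE := Riemann_measurable_exchanged M g RV.
have bV := RV.1; have bQV : bounded_set (torus_box `\` V).
  by have [] : Riemann_measurable (torus_box `\` V) by
    apply: Riemann_measurableD => //; exact: Riemann_measurable_box.
have bound x n : `|birkhoff alpha (exchanged V M g) n x - n%:R * 1| <= q%:R.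
  rewrite /exchanged birkhoffU//; try exact: bounded_set_shift.
  rewrite !birkhoff_preimage_shift -map_mxN birkhoff_shift_zvec.
  have -> : x - g = x - alpha *+ q + zvec (- m) by rewrite /g opprD addrA map_mxN.
  rewrite birkhoff_shift_zvec.
  have -> : birkhoff alpha (torus_box `\` V) n x = n%:R * 1 - birkhoff alpha V n x.
    rewrite -[n%:R * 1](_ : birkhoff alpha torus_box n x = _); last first.
      rewrite /birkhoff; under eq_bigr do rewrite chi_torus_box.
      by rewrite sumr_const card_ord mulr1.
    rewrite -[in X in birkhoff _ X _ _ - _](setDUK VQ) birkhoffU//; first by rewrite addrC addKr.
    by rewrite setDIK.
  rewrite (_ : _ - _ = birkhoff alpha V n (x - alpha *+ q) - birkhoff alpha V n x); last by lra.
  have h01 k : 0 <= chi V (x - alpha *+ q + alpha *+ k) <= 1.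
    rewrite chi_ge0 -(chi_torus_box (x - alpha *+ q + alpha *+ k)) le_chi//.
    exact: bounded_torus_box.
  have := sum_shift_bound q n h01.
  rewrite -/(birkhoff _ _ _ _) [X in _ - X](_ : _ = birkhoff alpha V n x)//.
  by apply: eq_bigr => k _; rewrite mulrnDr addrA subrK.
apply: (@ae_bounded_remainder_set _ _ _ _ q%:R); first exact: RE.1.
  exact: Riemann_measurable_measurable.
have nul n : null [set x | q%:R < `|birkhoff alpha (exchanged V M g) n x - n%:R * 1|].
  by apply: null_sub null0 => x /=; rewrite ltNge bound.
have D1 := density_eq_mes ler01 (ler0n _ q) RE.1 (Riemann_measurable_measurable RE) nul.
by rewrite -D1.
Qed.

Variables (alpha beta : 'rV[R]_d) (T U : {linear 'rV[R]_d -> 'rV[R]_d}).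
Hypotheses (d_gt0 : (0 < d)%N) (TU : cancel T U) (UT : cancel U T).
Hypothesis T_brs : forall S, Riemann_measurable S ->
  bounded_remainder_set alpha S -> bounded_remainder_set beta (T @` S).

Definition oscillation delta W n x : R :=
  birkhoff beta W n x - birkhoff beta W n (x - delta).

(** Apply the hypothesis to the sets obtained from V = T^-1 W by exchange with g and with
    0. Their images have the same measure and share the image of the rest of the
    fundamental domain, so subtracting leaves the oscillation of W. *)
Lemma oscillation_bounded (q : nat) m W : Riemann_measurable W -> W `<=` T @` torus_box ->
  exists C : R, forall n,
    null [set x | C < `|oscillation (T (alpha *+ q + zvec m)) W n x|].
Proof.
set g := _ + _ => RW WQ; pose V := T @^-1` W.
have VB x v : V (x - v) = W (T x - T v) by rewrite /V /preimage /= linearB.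
have RV : Riemann_measurable V by exact: Riemann_measurable_linear UT RW.
have VQ : V `<=` torus_box by move=> x /WQ[y Qy /(can_inj TU) <-].
clearbody V.
(* translating the first coordinate by N > |g_0| + 1 avoids both V and V + g *)
pose N : int := (Num.truncn `|g ord0 (Ordinal d_gt0)|).+1%:Z + 1.
pose M : 'rV[int]_d := const_mx N.
pose A := [set x | (torus_box `\` V) (x - zvec M)].
have RA : Riemann_measurable A.
  apply: Riemann_measurable_shift; apply: Riemann_measurableD => //.
  exact: Riemann_measurable_box.
have disj v : v ord0 (Ordinal d_gt0) <= `|g ord0 (Ordinal d_gt0)| ->
    A `&` [set x | V (x - v)] = set0.
  move=> vg; apply/seteqP; split => // x [[Qx _] /VQ Qv].
  have := Qx (Ordinal d_gt0); have := Qv (Ordinal d_gt0); rewrite !mxE /=.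
  have := truncnS_gt `|g ord0 (Ordinal d_gt0)|; rewrite /N intrD mulr1z -pmulrn; lra.
have RTA : Riemann_measurable (T @` A).
  rewrite (_ : T @` A = U @^-1` A); first exact: Riemann_measurable_linear TU RA.
  by apply/seteqP; split => [_ [x Ax <-]|x Ax] /=; [rewrite TU|exists (U x)].
have split_v v : v ord0 (Ordinal d_gt0) <= `|g ord0 (Ordinal d_gt0)| ->
   (T @` exchanged V M v = T @` A `|` [set y | W (y - T v)]) /\
   (T @` A) `&` [set y | W (y - T v)] = set0.
  move=> vg; have TVv : T @` [set x | V (x - v)] = [set y | W (y - T v)].
    apply/seteqP; split => [_ [x + <-]|y Wy] /=; first by move=> Vx; rewrite -VB.
    by exists (U y); rewrite /= ?VB UT.
  split; first by rewrite /exchanged image_setU TVv.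
  apply/seteqP; split => // _ [[x Ax <-] Wx].
  have : (A `&` [set x | V (x - v)]) x by split => //; rewrite /= VB.
  by rewrite disj.
have bW := RW.1; have bTA := RTA.1.
have mW := Riemann_measurable_measurable RW; have mTA := Riemann_measurable_measurable RTA.
pose s := fine (mes (T @` A : set (lebesgue_rV R d))) + fine (mes (W : set (lebesgue_rV R d))).
have key v (k : nat) (m' : 'rV[int]_d) : v = alpha *+ k + zvec m' ->
    v ord0 (Ordinal d_gt0) <= `|g ord0 (Ordinal d_gt0)| ->
    exists C : R, forall n, null [set x |
      C < `|birkhoff beta (T @` A) n x + birkhoff beta W n (x - T v) - n%:R * s|].
  move=> vE vg; have [TE TD] := split_v v vg.
  have brs : bounded_remainder_set alpha (exchanged V M v).
    by rewrite vE; apply: bounded_remainder_set_exchanged => //; rewrite -vE; exact: disj.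
  have := T_brs (Riemann_measurable_exchanged M v RV) brs; rewrite TE => brsT.
  have [C _ CT] := bounded_remainder_set_ae brsT; exists C => n.
  apply: null_sub CT => x /= Cx; exists n.
  rewrite birkhoffU//; last exact: bounded_set_shift.
  rewrite birkhoff_preimage_shift (_ : fine _ = s)//.
  rewrite [mes _]measureU//; last exact: measurable_shift.
  rewrite fineD ?bounded_mes_fin//; last exact: bounded_set_shift.
  by congr (_ + fine _); exact: lebesgue_outer_shift.
have [C1 C1P] : exists C : R, forall n, null [set x |
      C < `|birkhoff beta (T @` A) n x + birkhoff beta W n (x - T g) - n%:R * s|].
  by apply: (key g q m) => //; exact: ler_norm.
have [C0 C0P] : exists C : R, forall n, null [set x |
      C < `|birkhoff beta (T @` A) n x + birkhoff beta W n (x - T 0) - n%:R * s|].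
  apply: (key 0 0%N 0); last by rewrite mxE.
  by rewrite mulr0n add0r; apply/rowP => i; rewrite !mxE.
exists (C0 + C1) => n; apply: null_sub (nullU (C0P n) (C1P n)) => x /= Cx.
apply: contrapT => /not_orP[/= /negP + /negP]; rewrite linear0 subr0 -!leNgt => H0 H1.
move: Cx; rewrite ltNge => /negP; apply; rewrite /oscillation -/g.
move: H0 H1; rewrite !ler_norml => /andP[? ?] /andP[? ?].
by apply/andP; split; lra.
Qed.

End exchange.

(** * Approximation by integer vectors *)

Section diophantine.
Context {R : realType} {d : nat}.
Implicit Types (x y v w : 'rV[R]_d) (m : 'rV[int]_d).

Local Notation zvec k := (map_mx intr k : 'rV[R]_d).

Definition coord_lt (e : R) v := forall i, `|v ord0 i| < e.

Lemma le_coord_lt e e' v : e <= e' -> coord_lt e v -> coord_lt e' v.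
Proof. by move=> ee' ve i; exact: lt_le_trans (ve i) _. Qed.

Lemma coord_lt_mulrn e v (j : nat) : (0 < j)%N -> coord_lt e v -> coord_lt (j%:R * e) (v *+ j).
Proof.
by move=> j0 ve i; rewrite mulmxnE normrMn -[`|_| *+ _]mulr_natl ltr_pM2l// ltr0n.
Qed.

(** Dirichlet's pigeonhole argument in the unit cube cut into cells of side 1/L < e. *)
Lemma dirichlet_return beta (e : R) : 0 < e ->
  exists k m, (0 < k)%N /\ coord_lt e (beta *+ k + zvec m).
Proof.
move=> e0; pose L := (Num.truncn e^-1).+1.
have L0 : 0 < L%:R :> R by rewrite ltr0n.
have Le : L%:R^-1 < e.
  by rewrite -[e]invrK ltf_pV2 ?posrE ?invr_gt0// truncnS_gt.
clearbody L.
pose fr (j : nat) i : R := (beta *+ j) ord0 i - (Num.floor ((beta *+ j) ord0 i))%:~R.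
have fr01 j i : 0 <= fr j i < 1.
  have := floor_itv ((beta *+ j) ord0 i); rewrite intrD mulr1z /fr; lra.
have cellL j i : (Num.truncn (fr j i * L%:R) < L)%N.
  have /andP[f0 f1] := fr01 j i.
  by rewrite truncn_lt_nat ?mulr_ge0// -[ltRHS]mul1r ltr_pM2r.
pose cell (j : 'I_(#|{ffun 'I_d -> 'I_L}|.+1)) : {ffun 'I_d -> 'I_L} :=
  [ffun i => Ordinal (cellL j i)].
have [j [j' [jj' cjj']]] : exists j j' : 'I_(#|{ffun 'I_d -> 'I_L}|.+1),
    (j < j')%N /\ cell j = cell j'.
  have : ~~ injectiveb cell.
    by apply/negP => /injectiveP /leq_card; rewrite card_ord ltnn.
  move=> /injectivePn[j [j' jj' E]]; have [lt|lt|eq] := ltngtP j j'.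
  - by exists j, j'.
  - by exists j', j.
  - by move/negP: jj'; case; apply/eqP/val_inj.
exists (j' - j)%N.
pose fl (j : nat) : 'rV[int]_d := \row_i Num.floor ((beta *+ j) ord0 i).
exists (fl j - fl j'); split; first by rewrite subn_gt0.
move=> i; apply: lt_trans Le.
have -> : (beta *+ (j' - j) + zvec (fl j - fl j')) ord0 i = fr j' i - fr j i.
  have E1 : (beta *+ (j' - j)) ord0 i = (beta *+ j') ord0 i - (beta *+ j) ord0 i.
    by rewrite mulrnBr ?(ltnW jj')// mxE [X in _ + X]mxE.
  have E2 : zvec (fl j - fl j') ord0 i =
      (Num.floor ((beta *+ j) ord0 i))%:~R - (Num.floor ((beta *+ j') ord0 i))%:~R.
    by rewrite mxE mxE [X in _ + X]mxE intrB !mxE.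
  rewrite mxE E1 E2 /fr; move: (_ ord0 i) (_ ord0 i) (_%:~R) (_%:~R) => a b c e'.
  by ring.
have := congr1 (fun f : {ffun 'I_d -> 'I_L} => val (f i)) cjj'; rewrite !ffunE /= => E.
have /andP[f0 f1] := fr01 j i; have /andP[f0' f1'] := fr01 j' i.
have := @truncn_itv R (fr j i * L%:R); rewrite mulr_ge0// => /(_ isT).
have := @truncn_itv R (fr j' i * L%:R); rewrite mulr_ge0// => /(_ isT).
rewrite -E -natr1 -!ler_pdivrMr// -!ltr_pdivlMr//.
move: (Num.truncn _) => z; move: (fr j i) (fr j' i) => u u'.
rewrite mulrDl mul1r => /andP[? ?] /andP[? ?].
by rewrite ltr_norml; apply/andP; split; lra.
Qed.

(** Some coordinate of v is not an integer, and its distance to Z is positive. *)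
Lemma away_from_integers v : (forall m, v + zvec m != 0) ->
  exists2 r : R, 0 < r & forall m, ~ coord_lt r (v + zvec m).
Proof.
move=> vm; pose fl : 'rV[int]_d := \row_i Num.floor (v ord0 i).
have [i vi] : exists i, (Num.floor (v ord0 i))%:~R != v ord0 i.
  apply: contrapT => /forallNP nv; move/negP: (vm (- fl)); apply; apply/eqP/rowP => i.
  rewrite !mxE intrN; apply/eqP; rewrite subr_eq0 eq_sym.
  by have /negP/negPn := nv i.
have fv := floor_itv (v ord0 i); rewrite intrD mulr1z in fv.
set f : R := (Num.floor _)%:~R in vi fv.
exists (Num.min (v ord0 i - f) (f + 1 - v ord0 i)).
  by rewrite lt_min !subr_gt0 (andP fv).2 lt_neqAle vi (andP fv).1.
move=> m /(_ i); rewrite !mxE lt_min !ltr_norml => /andP[].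
have [ge0|lt0] := leP 0 (Num.floor (v ord0 i) + m ord0 i).
  have : 0 <= f + (m ord0 i)%:~R by rewrite /f -intrD ler0z.
  by move=> *; lra.
have : (Num.floor (v ord0 i) + m ord0 i)%:~R <= (-1)%:~R :> R by rewrite ler_int; lia.
rewrite intrD intrN mulr1z -/f.
by move=> *; lra.
Qed.

Lemma finite_min_radius (P : nat -> R -> Prop) (n : nat) :
  (forall (l : nat) (r r' : R), 0 < r' -> r' <= r -> P l r -> P l r') ->
  (forall l, (l < n)%N -> exists2 r : R, 0 < r & P l r) ->
  exists2 r : R, 0 < r & forall l, (l < n)%N -> P l r.
Proof.
move=> Pmono; elim: n => [|n IH] Pn; first by exists 1.
have [l ln|r r0 Pr] := IH; first by apply: Pn; exact: ltnW.
have [r' r'0 Pr'] := Pn n (ltnSn n).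
exists (Num.min r r'); first by rewrite lt_min r0.
move=> l; rewrite ltnS leq_eqVlt => /orP[/eqP ->|/Pr Plr].
  by apply: Pmono Pr'; rewrite ?lt_min ?r0// ge_min lexx orbT.
by apply: Pmono Plr; rewrite ?lt_min ?r0// ge_min lexx.
Qed.

End diophantine.

(** * The gliding hump *)

Section gliding_hump.
Context {R : realType} {d : nat}.
Implicit Types (p x y v w : 'rV[R]_d) (m : 'rV[int]_d) (A B S V W X : set 'rV[R]_d).

Local Notation zvec k := (map_mx intr k : 'rV[R]_d).

Variables (beta delta : 'rV[R]_d).
Hypotheses (d_gt0 : (0 < d)%N) (beta_irr : irrational_vector beta).
Hypothesis delta_out : ~ integer_span beta delta.

Lemma orbit_not_integer (l : nat) m : (0 < l)%N -> beta *+ l + zvec m != 0.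
Proof.
move=> l0; apply/negP => /eqP E.
have := @lattice_point_inj R d beta (row_mx (l%:Z)%:M m) d_gt0 beta_irr.
rewrite lattice_pointE row_mxKr row_mx_ord0 mxE mulr1n -pmulrn scaler_nat => /(_ E).
move=> /(congr1 (fun v : 'rV[int]_(1 + d) => v ord0 ord0)).
by rewrite row_mx_ord0 !mxE mulr1n; lia.
Qed.

Lemma orbit_sub_delta_not_integer (a b : nat) m m' :
  beta *+ a - delta - (beta *+ b + zvec m) + zvec m' != 0.
Proof.
apply/negP => /eqP E; apply: delta_out; exists (a%:Z - b%:Z), (m' - m).
rewrite intrB scalerBl -!pmulrn !scaler_nat map_mxB; apply/eqP.
rewrite -subr_eq0 -oppr_eq0 -[X in _ == X]E; apply/eqP/rowP => i; rewrite !mxE; lra.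
Qed.

Lemma sum_progression (f : nat -> R) (k M : nat) : (0 < k)%N -> (forall i, 0 <= f i) ->
  (forall j, (j < M)%N -> 1 <= f (j * k + k.-1)%N) -> M%:R <= \sum_(i < M * k) f i.
Proof.
move=> k0 f0; elim: M => [|M IH] fM; first by rewrite mul0n big_ord0.
rewrite mulSn addnC big_split_ord/= -natr1; apply: lerD.
  by apply: IH => j jM; apply: fM; exact: ltnW.
have kk : (k.-1 < k)%N by rewrite prednK.
rewrite (bigD1 (Ordinal kk))//=; apply: (@le_trans _ _ (f (M * k + k.-1)%N)).
  exact: fM.
by rewrite lerDl sumr_ge0.
Qed.

Lemma oscillationU V W n x : bounded_set V -> bounded_set W -> V `&` W = set0 ->
  oscillation beta delta (V `|` W) n x =
  oscillation beta delta V n x + oscillation beta delta W n x.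
Proof. by move=> bV bW VW; rewrite /oscillation !birkhoffU//; lra. Qed.

Definition cube p (r : R) : set 'rV[R]_d := [set y | coord_lt r (y - p)].

Lemma bounded_cube p r : bounded_set (cube p r).
Proof.
apply/bounded_setP; exists (`|r| + `|p| + 1); first by rewrite ltr_wpDl.
move=> y yp i; rewrite -[y](subrK p) mxE; apply: le_trans (ler_normD _ _) _.
have := yp i; have := ler_norm r; have := ler_coord_norm p i; lra.
Qed.

Lemma le_cube p r r' : r <= r' -> cube p r `<=` cube p r'.
Proof. by move=> rr y; exact: le_coord_lt. Qed.

Variables (p : 'rV[R]_d) (r0 : R).
Hypothesis r0_gt0 : 0 < r0.
Hypothesis osc_bounded : forall W, Riemann_measurable W -> W `<=` cube p r0 ->
  exists C : R, forall n, null [set x | C < `|oscillation beta delta W n x|].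

(** A state (V, r) of the construction: V is the union of the clusters built so far and
    the cube of radius r about p is reserved for the following ones. *)
Definition hump_state (s : set 'rV[R]_d * R) := [/\ Riemann_measurable s.1,
  s.1 `<=` cube p r0, s.1 `&` cube p s.2 = set0 & 0 < s.2 <= r0].

(** A step adds a cluster inside the reserved cube and shrinks the latter. The last
    clause provides an open cube of starting points such that, for almost all of them,
    the oscillation of the new union is at least N at some time n. Sets in the new
    reserved cube have oscillation zero there, so later clusters cannot alter this. *)
Definition hump_step (N : nat) (s s' : set 'rV[R]_d * R) := [/\ s.1 `<=` s'.1,
  s'.1 `\` s.1 `<=` cube p s.2, s'.2 <= s.2, s'.2 <= N.+1%:R^-1 &
  exists n z (e : R), [/\ 0 < e,
    null [set x | cube z e x /\ oscillation beta delta s'.1 n x < N%:R] &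
    forall x X, cube z e x -> X `<=` cube p s'.2 -> oscillation beta delta X n x = 0]].

(** With eps = k beta + m: the orbit of 0 translated by - delta avoids every j eps modulo
    Z^d, because delta is not in Z beta + Z^d, and the orbit itself never returns to 0,
    because beta is irrational. Finitely many such conditions leave a common margin. *)
Lemma radius_exists (k : nat) m (n M : nat) : exists2 rho : R, 0 < rho &
  (forall l j m', (l < n)%N -> (j < M)%N ->
     ~ coord_lt rho (beta *+ l - delta - (beta *+ k + zvec m) *+ j + zvec m')) /\
  (forall l m', (0 < l < n)%N -> ~ coord_lt rho (beta *+ l + zvec m')).
Proof.
pose P1 l r := forall j m', (j < M)%N ->
  ~ coord_lt r (beta *+ l - delta - (beta *+ k + zvec m) *+ j + zvec m').
pose P2 l (r : R) := (0 < l)%N -> forall m', ~ coord_lt r (beta *+ l + zvec m').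
have [||rho1 rho1_gt0 rhoP1] := @finite_min_radius R P1 n.
- by move=> l r r' r'0 rr Pr j m' jM cl; apply: (Pr j m' jM); exact: le_coord_lt cl.
- move=> l _; have [||rho rho_gt0 rhoP] := @finite_min_radius R (fun j r => forall m',
    ~ coord_lt r (beta *+ l - delta - (beta *+ k + zvec m) *+ j + zvec m')) M.
  + by move=> j r r' r'0 rr Pr m' cl; apply: (Pr m'); exact: le_coord_lt cl.
  + move=> j _; apply: away_from_integers => m'.
    have := orbit_sub_delta_not_integer l (k * j)%N (m *+ j) m'.
    by rewrite mulrnDl mulrnA raddfMn.
  + by exists rho => // j m' jM; exact: rhoP.
have [||rho2 rho2_gt0 rhoP2] := @finite_min_radius R P2 n.
- by move=> l r r' r'0 rr Pr l0 m' cl; apply: (Pr l0 m'); exact: le_coord_lt cl.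
- move=> l _; have [->|l0] := posnP l; first by exists 1.
  have [r r_gt0 rP] := @away_from_integers R d (beta *+ l) (fun m' => orbit_not_integer m' l0).
  by exists r.
exists (Num.min rho1 rho2); first by rewrite lt_min rho1_gt0.
split=> [l j m' ln jM cl|l m' /andP[l0 ln] cl].
  by apply: (rhoP1 l ln j m' jM); apply: le_coord_lt cl; rewrite ge_min lexx.
by apply: (rhoP2 l ln l0 m'); apply: le_coord_lt cl; rewrite ge_min lexx orbT.
Qed.

(** If C bounds the oscillation of the present union, a cluster with oscillation at least
    M >= N + C is enough. Choose a return eps = k beta + m of size less than r / (2 M) and
    put boxes around p + eps, ..., p + M eps: an orbit starting near p + beta visits the
    j-th box at time j k - 1, and its translate by - delta visits none. *)
Lemma hump_step_exists (N : nat) s : hump_state s -> exists2 s', hump_state s' & hump_step N s s'.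
Proof.
case: s => U r [/= RU Ur0 Ur /andP[r_gt0 rr0]].
have [C CU] := osc_bounded RU Ur0.
pose M := (Num.truncn (N%:R + `|C|)).+1.
have NCM : N%:R + C <= M%:R.
  by have := truncnS_gt (N%:R + `|C|); have := ler_norm C; rewrite -/M; lra.
have M_gt0 : 0 < M%:R :> R by rewrite ltr0n.
have [k [m [k_gt0 km]]] : exists k m,
    (0 < k)%N /\ coord_lt (r / (2 * M%:R)) (beta *+ k + zvec m).
  by apply: dirichlet_return; rewrite divr_gt0// mulr_gt0.
set eps := beta *+ k + zvec m in km.
pose n := (M * k)%N.
(* index 0 of j stands for the centre p, indices 1 to M for the boxes *)
have [rho rho_gt0 [rho1 rho2]] := radius_exists k m n.+1 M.+1; rewrite -/eps in rho1.
have kn : (k < n.+1)%N by rewrite ltnS leq_pmull.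
pose t := Num.min (rho / 2) (r / 4).
have t_gt0 : 0 < t by rewrite lt_min !divr_gt0.
have t_rho : t + t <= rho.
  have : t <= rho / 2 by rewrite ge_min lexx.
  lra.
have t_r : t <= r / 4 by rewrite ge_min lexx orbT.
pose h (j : nat) := p + eps *+ j.
pose b j : set 'rV[R]_d := box (h j.+1 - const_mx t, h j.+1 + const_mx t).
pose V := \bigcup_(j in `I_M) b j.
have bclose j y : b j y -> forall i, `|(y - h j.+1) ord0 i| <= t.
  by move=> yb i; have := yb i; rewrite !mxE /= ler_norml; lra.
have closeb j y : coord_lt t (y - h j.+1) -> b j y.
  by move=> yh i; have := yh i; rewrite !mxE /= ltr_norml; lra.
have RV : Riemann_measurable V.
  rewrite /V bigcup_mkord; elim/big_ind : _ => //.
  - exact: Riemann_measurable0.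
  - by move=> A B; exact: Riemann_measurableU.
  - by move=> j _; exact: Riemann_measurable_box.
have Vr : V `<=` cube p r.
  move=> y [j /= jM yb] i.
  have -> : y - p = (y - h j.+1) + eps *+ j.+1 by rewrite /h opprD addrA subrK.
  rewrite mxE; apply: le_lt_trans (ler_normD _ _) _.
  have y1 := bclose j y yb i; have y2 := coord_lt_mulrn (ltn0Sn j) km i.
  have jr : j.+1%:R * (r / (2 * M%:R)) <= r / 2.
    rewrite mulrA ler_pdivrMr; last by rewrite mulr_gt0.
    rewrite mulrA divfK ?pnatr_eq0// mulrC ler_pM2l//.
    by rewrite ler_nat.
  by move: y1 y2 => *; lra.
have Vt : V `&` cube p t = set0.
  apply/seteqP; split => // y [[j /= jM yb] yt].
  apply: (rho2 k m); first by rewrite k_gt0.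
  rewrite -/eps => i; have y1 := bclose j y yb i; have y2 := yt i.
  have E : (eps *+ j.+1) ord0 i = (y - p) ord0 i - (y - h j.+1) ord0 i.
    by rewrite /h !mxE; lra.
  have : `|(eps *+ j.+1) ord0 i| < rho.
    by rewrite E; apply: le_lt_trans (ler_normB _ _) _; move: y1 y2 => *; lra.
  apply: le_lt_trans; rewrite mulmxnE normrMn mulrS lerDl.
  by rewrite mulrn_wge0.
have UV : U `&` V = set0.
  apply/seteqP; split => // y [Uy /Vr yr].
  have : (U `&` cube p r) y by split.
  by rewrite Ur.
pose r' := Num.min t N.+1%:R^-1.
have r'_gt0 : 0 < r' by rewrite lt_min t_gt0 invr_gt0 ltr0n.
have r't : r' <= t by rewrite ge_min lexx.
have tr : t <= r by lra.
exists (U `|` V, r'); split => /=.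
- exact: Riemann_measurableU.
- by move=> y [/Ur0//|/Vr]; exact: le_cube.
- apply/seteqP; split => // y [[Uy|Vy] yr'].
    have : (U `&` cube p r) y by split => //; apply: le_cube yr'; lra.
    by rewrite Ur.
  have : (V `&` cube p t) y by split => //; apply: le_cube yr'.
  by rewrite Vt.
- by rewrite r'_gt0/=; lra.
- by left.
- by move=> y [[//|/Vr]].
- lra.
- by rewrite ge_min lexx orbT.
exists n, (p + beta), t; split => //.
  have oscV x : cube (p + beta) t x -> M%:R <= oscillation beta delta V n x.
    move=> xz; rewrite /oscillation [X in _ - X]birkhoff_eq0 ?subr0; last first.
      move=> i m' ni [j /= jM yb].
      apply: (rho1 i.+1 j.+1 m') => // q.
      have y1 := bclose _ _ yb q; have y2 := xz q.
      set y := x - delta + _ + _ in yb y1.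
      rewrite (_ : _ ord0 q = (y - h j.+1) ord0 q - (x - (p + beta)) ord0 q); last first.
        by rewrite /y /h mulrSr !mxE; lra.
      by apply: le_lt_trans (ler_normB _ _) _; move: y1 y2 => *; lra.
    apply: (@sum_progression (fun i => chi V (x + beta *+ i))) => // [i|j jM].
      exact: chi_ge0.
    apply: (@chi_ge1 _ _ _ _ (m *+ j.+1)); first exact: RV.1.
    exists j => //; apply: closeb => q.
    rewrite (_ : _ ord0 q = (x - (p + beta)) ord0 q)//.
    have E : beta *+ (j * k + k.-1) + beta = beta *+ (k * j.+1).
      by rewrite -mulrSr -addnS prednK// addnC -mulSn mulnC.
    rewrite /h /eps raddfMn mulrnDl -mulrnA -E !mxE; lra.
  apply: null_sub (CU n) => x [/oscV oV] /=; apply: contraPP => /negP; rewrite -leNgt.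
  rewrite (oscillationU _ _ RU.1 RV.1 UV).
  by rewrite ler_norml => /andP[? _]; apply/negP; rewrite -leNgt; lra.
move=> x X xz Xr'; rewrite /oscillation !birkhoff_eq0 ?subrr// => i m' ni /Xr' yr'.
  apply: (rho1 i.+1 0%N m') => // q; have y1 := yr' q; have y2 := xz q.
  set y := x - delta + _ + _ in yr' y1.
  rewrite (_ : _ ord0 q = (y - p) ord0 q - (x - (p + beta)) ord0 q); last first.
    by rewrite /y mulr0n mulrSr !mxE; lra.
  by apply: le_lt_trans (ler_normB _ _) _; move: y1 y2 => *; lra.
apply: (rho2 i.+1 m') => // q; have y1 := yr' q; have y2 := xz q.
set y := x + _ + _ in yr' y1.
rewrite (_ : _ ord0 q = (y - p) ord0 q - (x - (p + beta)) ord0 q); last first.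
  by rewrite /y mulrSr !mxE; lra.
by apply: le_lt_trans (ler_normB _ _) _; move: y1 y2 => *; lra.
Qed.

(** The union W of all clusters coincides with a finite stage outside any neighbourhood
    of p, so its boundary is p together with the boundaries of the stages, and W is
    Riemann measurable. Its oscillation exceeds every N on a nonempty open set. *)
Lemma oscillation_unbounded : False.
Proof.
have state0 : hump_state (set0, r0).
  split => //=; last by rewrite r0_gt0 lexx.
  - exact: Riemann_measurable0.
  - by rewrite set0I.
pose St := {s : set 'rV[R]_d * R | hump_state s}.
have next (N : nat) (s : St) : {s' : St | hump_step N (sval s) (sval s')}.
  apply: cid; have [s' Hs' step] := hump_step_exists N (svalP s).
  by exists (exist _ s' Hs').
pose sq := fix sq (N : nat) : St :=
  if N is N'.+1 then sval (next N' (sq N')) else exist _ _ state0.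
pose U N := (sval (sq N)).1; pose r N := (sval (sq N)).2.
have stepN N : hump_step N (sval (sq N)) (sval (sq N.+1)) by exact: svalP (next N (sq N)).
have stateN N : hump_state (sval (sq N)) := svalP (sq N).
have UM N k : U N `<=` U (N + k)%N.
  elim: k => [|k IH]; first by rewrite addn0.
  by rewrite addnS; apply: subset_trans IH _; have [] := stepN (N + k)%N.
have rM N k : r (N + k)%N <= r N.
  elim: k => [|k IH]; first by rewrite addn0.
  by rewrite addnS; apply: le_trans IH; have [] := stepN (N + k)%N.
have tail N k : U (N + k)%N `\` U N `<=` cube p (r N).
  elim: k => [|k IH]; first by rewrite addn0 setDv.
  rewrite addnS => y [Uy nUy]; have [Uy'|nUy'] := pselect (U (N + k)%N y).
    by apply: IH; split.
  have [_ D _ _ _] := stepN (N + k)%N.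
  by apply: le_cube (rM N k) _ _; apply: D; split.
pose W := \bigcup_N U N.
have WU N : W `\` U N `<=` cube p (r N).
  move=> y [[k _ Uk] nU]; have [kN|/ltnW Nk] := leqP k N.
    by exfalso; apply: nU; rewrite -(subnKC kN); exact: UM.
  by apply: (tail N (k - N)%N); rewrite subnKC.
have W0 : W `<=` cube p r0 by move=> y [N _]; have [_ + _ _] := stateN N; exact.
have RW : Riemann_measurable W.
  split.
    have /bounded_setP[C C0 cC] := @bounded_cube p r0.
    by apply/bounded_setP; exists C => // y /W0/cC.
  suff : null (boundary W) by [].
  pose q := Ordinal d_gt0.
  suff sub : boundary W `<=`
      ([set x : 'rV[R]_d | x ord0 q = p ord0 q] `|` \bigcup_N boundary (U N)).
    apply: null_sub sub _.
    apply: nullU; first exact: null_hyperplane.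
    by apply: null_bigcup => N; have [[_ ?] _ _ _] := stateN N.
  move=> x [cx nx]; have [xp|/eqP xp] := pselect (x ord0 q = p ord0 q); first by left.
  pose e := `|x ord0 q - p ord0 q| / 2.
  have e0 : 0 < e by rewrite divr_gt0// normr_gt0 subr_eq0.
  pose N := Num.truncn e^-1.
  have rN : r N.+1 <= e.
    have [_ _ _ h _] := stepN N; apply: le_trans h _; apply: ltW.
    by rewrite -[e]invrK ltf_pV2 ?posrE ?invr_gt0// truncnS_gt.
  right; exists N.+1 => //; split; last first.
    by move=> iU; apply: nx; apply: filterS iU => y Uy; exists N.+1.
  move=> B xB.
  have xO : nbhs x [set y : 'rV[R]_d | forall i, `|y ord0 i - x ord0 i| < e].
    by apply/nbhs_rVP; exists e.
  have [y [Wy [By yx]]] := cx _ (filterI xB xO).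
  exists y; split => //; apply: contrapT => nUy.
  have yp : cube p (r N.+1) y by apply: WU; split.
  have := yp q; have := yx q; rewrite !mxE.
  have := ler_distD (y ord0 q) (x ord0 q) (p ord0 q).
  rewrite [`|x ord0 q - y ord0 q|]distrC.
  have : `|x ord0 q - p ord0 q| = e + e by rewrite /e; lra.
  by move=> *; lra.
have [C CW] := osc_bounded RW W0.
pose N := Num.truncn `|C|.
have CN : C < N.+1%:R by apply: le_lt_trans (ler_norm C) _; exact: truncnS_gt.
have [_ _ _ _ [n [z [e [e0 oscN osc0]]]]] := stepN N.+1.
apply: (@not_null_cube R d z e e0); apply: null_sub (nullU oscN (CW n)) => x xz.
have xz' : cube z e x by move=> i; rewrite !mxE; exact: xz.
have [lt|ge] := ltP (oscillation beta delta (U N.+2) n x) N.+1%:R; first by left.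
right => /=; apply: lt_le_trans (ler_norm _).
have bU : bounded_set (U N.+2) by have [[]] := stateN N.+2.
have UW : U N.+2 `<=` W by move=> y Uy; exists N.+2.
have bD : bounded_set (W `\` U N.+2).
  have /bounded_setP[K K0 KW] := RW.1.
  by apply/bounded_setP; exists K => // y [/KW].
rewrite -(setDUK UW) oscillationU//; last by rewrite setDIK.
rewrite (osc0 x (W `\` U N.+2) xz' (WU N.+2)).
by rewrite addr0; exact: lt_le_trans CN ge.
Qed.

End gliding_hump.

(** * Bounded remainder sets determine the group *)

Section necessity.
Context {R : realType} {d : nat}.

Lemma integer_spanN (alpha v : 'rV[R]_d) : integer_span alpha v -> integer_span alpha (- v).
Proof.
move=> [n [m ->]]; exists (- n), (- m).
by rewrite intrN scaleNr map_mxN opprD.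
Qed.

Variables (alpha beta : 'rV[R]_d) (T U : {linear 'rV[R]_d -> 'rV[R]_d}).
Hypotheses (d_gt0 : (0 < d)%N) (TU : cancel T U) (UT : cancel U T).
Hypothesis beta_irr : irrational_vector beta.
Hypothesis T_brs : forall S, Riemann_measurable S ->
  bounded_remainder_set alpha S -> bounded_remainder_set beta (T @` S).

(** Around the image p of the centre of the fundamental box there is a cube inside the
    image of the box, and there oscillations are bounded. *)
Lemma image_integer_span_nat (q : nat) (m : 'rV[int]_d) :
  integer_span beta (T (alpha *+ q + map_mx intr m)).
Proof.
apply: contrapT => out; have [L L0 UL] := linear_bound U.
pose p : 'rV[R]_d := T (const_mx 2^-1).
have r0_gt0 : 0 < (2 * L)^-1 by rewrite invr_gt0 mulr_gt0.
apply: (@oscillation_unbounded R d beta _ d_gt0 beta_irr out p (2 * L)^-1 r0_gt0) => W RW Wp.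
apply: (oscillation_bounded d_gt0 TU UT T_brs) => // y /Wp yp.
exists (U y); last exact: UT.
have half : L * (2 * L)^-1 = 2^-1 by rewrite invfM mulrCA divff ?mulr1// gt_eqF.
move=> i; have := UL _ (y - p) r0_gt0 (fun j => ltW (yp j)) i.
by rewrite linearB half /p TU !mxE ltr_norml /=; lra.
Qed.

Lemma image_integer_span : T @` integer_span alpha `<=` integer_span beta.
Proof.
move=> _ [_ [n [m ->]] <-]; case: (intP n) => [|k|k].
- by have := image_integer_span_nat 0 m; rewrite mulr0n scale0r.
- by have := image_integer_span_nat k.+1 m; rewrite -pmulrn scaler_nat.
rewrite -[X in integer_span _ X]opprK; apply: integer_spanN.
have := image_integer_span_nat k.+1 (- m).
by rewrite -linearN opprD intrN scaleNr opprK map_mxN -pmulrn scaler_nat.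
Qed.

End necessity.

Theorem theorem5 (R : realType) (d : nat) (hd : (1 <= d)%N)
    (alpha beta : 'rV[R]_d)
    (halpha : irrational_vector alpha) (hbeta : irrational_vector beta)
    (T : {linear 'rV[R]_d -> 'rV[R]_d}) (hT : bijective T) :
  (forall S : set 'rV[R]_d, Riemann_measurable S ->
     bounded_remainder_set alpha S -> bounded_remainder_set beta (T @` S))
  <->
  T @` integer_span alpha `<=` integer_span beta.
Proof.
have [U [TU UT]] := linear_inverse hT; split; first exact: (image_integer_span hd TU UT hbeta).
move=> /integer_span_matrix[A TA] S.
apply: (bounded_remainder_set_linear TU UT TA) => l lA.
apply: (lattice_point_inj hd halpha); apply: (can_inj TU).
by rewrite TA lA linear0 /lattice_point map_mx0 mul0mx.
Qed.
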